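(* Every Gauss code can be realized as the code for a virtual graph diagram. That is, for every finite connected directed graph $G$ and every abstract Gauss code $C$ on $G$, there is a virtual graph diagram of $G$ whose Gauss code is $C$.
   Context: Graphs are finite, connected and directed (loops and multiple edges allowed). Virtual graph diagrams. A (classical) graph diagram of $G$ is a projection to the plane of an embedding of $G$ in $\mathbb{R}^3$ such that a neighborhood of each vertex is a collection of rays with one end at the vertex, and the only singularities are finitely many transverse double points in the interiors of edges, each decorated with over/under information; these are the classical crossings. A virtual graph diagram of $G$ is a generic immersion of $G$ in the plane of the same kind (embedded near vertices, finitely many transverse double points in the interiors of edges) in which each double point is designated either a classical crossing (with over/under information) or a virtual crossing (drawn with a small circle around it, carrying no over/under information). Each classical crossing has a sign $+$ or $-$, determined in the usual way (as for oriented link diagrams) by the orientations of the edges and the over/under information. Gauss codes. An (abstract) Gauss code on $G$ consists of: (1) for each vertex of $G$, a cyclic ordering of the edge-ends incident to it; (2) for each edge of $G$, a finite sequence (possibly empty) of symbols from some alphabet, such that every symbol that is used occurs exactly twice in the whole collection of sequences; (3) for each occurrence of a symbol, a label ''over'' (o) or ''under'' (u) and a sign $+$ or $-$, such that the two occurrences of each symbol have the same sign and opposite over/under labels. The Gauss code of a virtual graph diagram is obtained by labeling the classical crossings with distinct symbols, recording for each edge the sequence of classical crossings met when traversing the edge in the direction of its orientation, together with whether the edge passes over or under at that crossing and the sign of the crossing, and recording the (counterclockwise) cyclic order of the edge-ends around each vertex. Virtual crossings are ignored. Gauss codes are considered up to renaming of symbols. *)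

(* Defs.v *)
From HB Require Import structures.
From mathcomp Require Import all_boot all_order all_algebra all_fingroup.
From mathcomp Require Import all_classical all_reals all_analysis.

Set Implicit Arguments.
Unset Strict Implicit.
Unset Printing Implicit Defensive.

Import Order.TTheory GRing.Theory Num.Theory.
Import numFieldNormedType.Exports.

Local Open Scope classical_set_scope.
Local Open Scope ring_scope.

Record digraph := Digraph {
  vertex : finType;
  edge : finType;
  source : edge -> vertex;
  target : edge -> vertex }.

Definition adjacent (G : digraph) : rel (vertex G) := fun u v =>
  [exists e : edge G, ((source e == u) && (target e == v))
                   || ((source e == v) && (target e == u))].

Definition connected_graph (G : digraph) : Prop :=
  forall u v : vertex G, connect (@adjacent G) u v.

(* [(e, false)] is the initial end of the edge [e], [(e, true)] its terminal
   end; a loop has two distinct ends at the same vertex. *)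
Definition edge_end (G : digraph) : finType := (edge G * bool)%type.

Definition end_vertex (G : digraph) (h : edge_end G) : vertex G :=
  if h.2 then target h.1 else source h.1.

(* [is_over] is the label o/u, [is_pos] the sign +/-. *)
Record gauss_entry (A : Type) := GaussEntry {
  symbol : A;
  is_over : bool;
  is_pos : bool }.

Definition occurrences (G : digraph) (A : eqType)
    (w : edge G -> seq (gauss_entry A)) (a : A) : nat :=
  (\sum_(e : edge G) count (fun x => symbol x == a) (w e))%N.

(* The cyclic orderings at the vertices are given by the successor permutation
   [rotation] of the edge-ends, whose cycles are the sets of all ends incident
   to a given vertex. *)
Record gauss_code (G : digraph) (A : eqType) := GaussCode {
  rotation : {perm edge_end G};
  rotationP : forall h k : edge_end G,
    (k \in porbit rotation h) = (end_vertex k == end_vertex h);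
  word : edge G -> seq (gauss_entry A);
  word_twice : forall a : A,
    occurrences word a = 0%N \/ occurrences word a = 2%N;
  word_match : forall (e f : edge G) (i j : nat) (x y : gauss_entry A),
    (e, i) <> (f, j) ->
    onth (word e) i = Some x -> onth (word f) j = Some y ->
    symbol x = symbol y ->
    is_pos x = is_pos y /\ is_over x = ~~ is_over y }.

Definition det2 (R : realType) (a b : R * R) : R := a.1 * b.2 - a.2 * b.1.

(* For pairwise distinct directions: going counterclockwise from [a] one meets
   [b] before [c].  The three counterclockwise angles from [a] to [b], [b] to
   [c] and [c] to [a] then add up to one full turn rather than two, i.e. at
   least two of them are smaller than a half turn. *)
Definition ccw (R : realType) (a b c : R * R) : Prop :=
  [\/ 0 < det2 a b /\ 0 < det2 b c,
      0 < det2 b c /\ 0 < det2 c a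
    | 0 < det2 c a /\ 0 < det2 a b].

Definition same_direction (R : realType) (a b : R * R) : Prop :=
  exists2 r : R, 0 < r & a = (r * b.1, r * b.2).

Definition velocity (R : realType) (c : R -> R * R) (t : R) : R * R :=
  (derive1 (fun u => (c u).1 : R) t, derive1 (fun u => (c u).2 : R) t).

(* Only the restriction to [0, 1] of such a function is used as a curve; asking
   for C^1 on the whole line costs nothing, as C^1 functions on [0, 1] extend. *)
Definition C1_curve (R : realType) (c : R -> R * R) : Prop :=
  [/\ forall t : R, derivable (fun u => (c u).1 : R) t 1,
      forall t : R, derivable (fun u => (c u).2 : R) t 1,
      continuous (fun t => (velocity c t).1 : R)
    & continuous (fun t => (velocity c t).2 : R)].

Section Drawing.
Variables (R : realType) (G : digraph) (curve : edge G -> R -> R * R).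

(* The sign makes the direction point away from the vertex at both ends. *)
Definition end_direction (h : edge_end G) : R * R :=
  if h.2 then (- (velocity (curve h.1) 1).1, - (velocity (curve h.1) 1).2)
  else velocity (curve h.1) 0.

Definition end_point (h : edge_end G) (t : R) : R * R :=
  curve h.1 (if h.2 then 1 - t else t).

Definition meets (e : edge G) (s : R) (f : edge G) (t : R) : Prop :=
  [/\ 0 < s < 1, 0 < t < 1, (e, s) <> (f, t) & curve e s = curve f t].

Definition double_point (p : R * R) : Prop :=
  exists e s f t, meets e s f t /\ p = curve e s.

End Drawing.

(* [strand e s] describes the passage of the edge [e] at parameter [s] through
   a double point: [None] if the crossing is virtual, [Some true] if it is
   classical and [e] passes over, [Some false] if it is classical and [e] passes
   under.  Its values away from double points are irrelevant. *)
Record virtual_diagram (R : realType) (G : digraph) := VirtualDiagram {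
  place : vertex G -> R * R;
  curve : edge G -> R -> R * R;
  strand : edge G -> R -> option bool;
  curve_source : forall e, curve e 0 = place (source e);
  curve_target : forall e, curve e 1 = place (target e);
  curve_C1 : forall e, C1_curve (curve e);
  curve_immersed : forall e t, 0 <= t <= 1 -> velocity (curve e) t <> (0, 0);
  (* By compactness of [0, 1] the next four fields say that a neighborhood of
     each vertex is a collection of distinct rays issued from it. *)
  place_inj : injective place;
  vertex_simple : forall e t v, 0 < t < 1 -> curve e t <> place v;
  end_straight : forall h, exists2 eps : R, 0 < eps &
    forall t, 0 <= t <= eps -> exists2 r : R, 0 <= r &
      end_point curve h t =
        ((place (end_vertex h)).1 + r * (end_direction curve h).1,
         (place (end_vertex h)).2 + r * (end_direction curve h).2);
  end_distinct : forall h k, end_vertex h = end_vertex k -> h <> k ->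
    ~ same_direction (end_direction curve h) (end_direction curve k);
  double_finite : finite_set [set p | double_point curve p];
  double_transverse : forall e s f t, meets curve e s f t ->
    det2 (velocity (curve e) s) (velocity (curve f) t) <> 0;
  no_triple : forall e s f t g u,
    meets curve e s f t -> meets curve e s g u -> (f, t) = (g, u);
  strandP : forall e s f t, meets curve e s f t ->
    strand f t = omap negb (strand e s) }.

Section CodeOfDiagram.
Variables (R : realType) (G : digraph) (D : virtual_diagram R G).

Definition classical_passage (e : edge G) (s : R) : Prop :=
  (exists f t, meets (curve D) e s f t) /\ strand D e s <> None.

Definition classical_crossing (p : R * R) : Prop :=
  exists e s, classical_passage e s /\ p = curve D e s.

(* A classical crossing is positive when (over tangent, under tangent) is a
   positively oriented frame; here [e] at [s] is the over strand. *)
Definition positive_over (e : edge G) (s : R) (f : edge G) (t : R) : bool :=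
  0 < det2 (velocity (curve D e) s) (velocity (curve D f) t).

Definition records_passage (A : eqType) (label : R * R -> option A)
    (e : edge G) (s : R) (x : gauss_entry A) : Prop :=
  [/\ label (curve D e s) = Some (symbol x),
      strand D e s = Some (is_over x)
    & forall f t, meets (curve D) e s f t ->
        is_pos x = if is_over x then positive_over e s f t
                   else positive_over f t e s].

(* [C] is a Gauss code of [D], for some labeling of the classical crossings by
   distinct symbols.  [label] is partial because the alphabet may be empty. *)
Definition is_gauss_code_of (A : eqType) (C : gauss_code G A) : Prop :=
  (forall h k : edge_end G,
     end_vertex k = end_vertex h -> k <> h -> k <> rotation C h ->
     ccw (end_direction (curve D) h)
         (end_direction (curve D) (rotation C h))
         (end_direction (curve D) k))
  /\
  exists label : R * R -> option A,
    (forall p q, classical_crossing p -> classical_crossing q ->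
       label p = label q -> p = q) /\
    forall e : edge G, exists times : seq R,
      [/\ sorted <%R times,
          forall s, s \in times <-> classical_passage e s,
          size (word C e) = size times
        & forall i s x, onth times i = Some s -> onth (word C e) i = Some x ->
            records_passage label e s x].

End CodeOfDiagram.

(* Main.v *)
(** The edges are drawn as chains of arcs through "ports" on the x-axis, all
    crossed vertically.  A passage through a classical crossing is an arc in
    the lower half-plane, successive passages are joined by arcs in the upper
    half-plane, and each edge-end runs from its vertex, at height -1, up to a
    port.  All arcs have the same height profile, so two points at equal height
    on two arcs (one of them possibly reversed) have equal parameters: a double
    point is a solution of a linear equation in one unknown, and for generic
    ports all double points are transverse and none is triple.  The arc of the
    over-passage is placed around the arc of the under-passage, with a different
    midpoint; they then meet twice, with opposite signs.  The meeting with the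
    prescribed sign is made classical and all other double points virtual. *)

Require Import Defs.
From mathcomp Require Import all_boot all_order all_algebra all_fingroup.
From mathcomp Require Import all_classical all_reals all_analysis.
From mathcomp Require Import ring lra zify.

Set Implicit Arguments.
Unset Strict Implicit.
Unset Printing Implicit Defensive.

Import Order.TTheory GRing.Theory Num.Theory.
Import numFieldNormedType.Exports.

Local Open Scope classical_set_scope.
Local Open Scope ring_scope.


(** * Gluing C^1 functions *)

(** The node positions are the only free parameters, and the profiles are chosen to keep them free:
    up to the time scale of its edge, every piece reaches its ports with horizontal speed 0 and
    vertical speed 1 or -1, so the pieces glue to a C^1 curve for any positions. Write [h] for the
    common value of the horizontal profile. Strands of one layer from [a] to [b] and from [c] to [d]
    then meet where (a - c)(1 - h) + (b - d)h = 0. Genericity amounts to sum conditions such as a +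
    d <> b + c for transversality, and to non-collinearity of (a, b), (c, d), (a', b') against
    triple points. Both need distinct nodes, which is why successive pieces of an edge, sharing a
    port, lie in layers without common height. The heights of vertex strands and lower arcs do
    overlap, so these are kept apart horizontally. Two nested arcs with the same midpoint would be
    tangent at the bottom instead of crossing twice; a factor 2 between the right ends of the arcs
    rules this out. *)

Definition has_C1_derivative (R : realType) (f df : R -> R) : Prop :=
  (forall t : R, is_derive t (1 : R) f (df t)) /\ continuous df.

Lemma horner_C1 (R : realType) (p : {poly R}) :
  has_C1_derivative (horner p) (horner p^`()).
Proof. by split=> [t|]; [exact: is_derive_poly | exact: continuous_horner]. Qed.

Lemma affine_comp_C1 (R : realType) (f df : R -> R) (a b c d : R) :
  has_C1_derivative f df ->
  has_C1_derivative (fun t => a + b * f (c * t + d))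
                    (fun t => b * (c * df (c * t + d))).
Proof.
move=> [Df Cf].
have [Da Ca] := horner_C1 (c%:P * 'X + d%:P).
have [Db Cb] := horner_C1 (b%:P * 'X + a%:P).
have Ea t : c * t + d = (c%:P * 'X + d%:P).[t] by rewrite !hornerE.
split=> [t|t].
  have -> : (fun t => a + b * f (c * t + d)) =
     horner (b%:P * 'X + a%:P) \o (f \o horner (c%:P * 'X + d%:P)).
    by apply/funext => x; rewrite /= !hornerE addrC.
  have -> : b * (c * df (c * t + d)) =
     (b%:P * 'X + a%:P)^`().[f ((c%:P * 'X + d%:P).[t])] *
     (df (c * t + d) * (c%:P * 'X + d%:P)^`().[t]).
    by rewrite !poly.derivE !hornerE; exact: mulrAC.
  apply: is_derive1_comp => //; apply: is_derive1_comp => //.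
  by rewrite -Ea.
have -> : (fun t => b * (c * df (c * t + d))) =
   (fun t => (b * c) * df (horner (c%:P * 'X + d%:P) t)).
  by apply/funext => x; rewrite -Ea mulrA.
apply: cvgM; first exact: cvg_cst.
by apply: continuous_comp; [exact: continuous_horner | exact: Cf].
Qed.

(** Away from [a] the glued function agrees locally with one piece. At [a] the difference quotients
    of both pieces tend to the same limit, so it does not matter which branch each increment
    selects. *)
Lemma glue_C1 (R : realType) (f df g dg : R -> R) (a : R) :
  has_C1_derivative f df -> has_C1_derivative g dg ->
  f a = g a -> df a = dg a ->
  has_C1_derivative (fun t => if t <= a then f t else g t)
                    (fun t => if t <= a then df t else dg t).
Proof.
move=> [Df Cf] [Dg Cg] fga dfga; split=> t.
  case: (ltgtP t a) => [ta|ta|->].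
  - apply: near_eq_is_derive (Df t); near=> x.
    suff -> : x <= a by [].
    by apply/ltW; near: x; exact: lt_nbhsl.
  - apply: near_eq_is_derive (Dg t); near=> x.
    suff -> : (x <= a) = false by [].
    by apply/negbTE; rewrite -ltNge; near: x; exact: lt_nbhsr.
  - set F := fun _ => _.
    suff HF : h^-1 *: ((F \o shift a) (h *: (1 : R)) - F a) @[h --> 0^'] --> df a.
      split; first by apply/cvg_ex; exists (df a).
      exact: cvg_lim HF.
    have [_ Vf] := Df a; have [_ Vg] := Dg a.
    have Hf : h^-1 *: ((f \o shift a) (h *: (1 : R)) - f a) @[h --> 0^'] --> df a.
      by rewrite -Vf; have [/cvg_ex [l Hl] _] := Df a; rewrite /derive (cvg_lim _ Hl).
    have Hg : h^-1 *: ((g \o shift a) (h *: (1 : R)) - g a) @[h --> 0^'] --> df a.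
      by rewrite dfga -Vg; have [/cvg_ex [l Hl] _] := Dg a; rewrite /derive (cvg_lim _ Hl).
    apply/cvgrPdist_lt => e e0.
    move/cvgrPdist_lt/(_ _ e0): Hf => Hf; move/cvgrPdist_lt/(_ _ e0): Hg => Hg.
    near=> h.
    have -> : F a = f a by rewrite /F lexx.
    rewrite /F /=; case: ifP => _; first by near: h; exact: Hf.
    by rewrite fga; near: h; exact: Hg.
apply/cvgrPdist_lt => e e0.
have Hf := proj1 (cvgrPdist_lt _ _) (Cf t) e e0.
have Hg := proj1 (cvgrPdist_lt _ _) (Cg t) e e0.
case: (ltgtP t a) => [ta|ta|ta].
- near=> x.
  have -> : x <= a by apply/ltW; near: x; exact: lt_nbhsl.
  by near: x; exact: Hf.
- near=> x.
  have -> : (x <= a) = false.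
    by apply/negbTE; rewrite -ltNge; near: x; exact: lt_nbhsr.
  by near: x; exact: Hg.
- near=> x; case: ifP => _; first by near: x; exact: Hf.
  by rewrite ta dfga -ta; near: x; exact: Hg.
Unshelve. all: by end_near. Qed.

(** Piece [k] serves on [k, k + 1]; the first and the last piece continue to infinity, as [C1_curve]
    asks for a function on the whole line. *)
Fixpoint glue_pieces (R : realType) (f : nat -> R -> R) (n : nat) : R -> R :=
  if n is m.+1 then
    fun t => if t <= m.+1%:R then glue_pieces f m t else f m.+1 t
  else f 0.

Lemma glue_pieces_on (R : realType) (f : nat -> R -> R) (n k : nat) (t : R) :
  (forall k, (k < n)%N -> f k k.+1%:R = f k.+1 k.+1%:R) ->
  (k <= n)%N -> k%:R <= t <= k.+1%:R -> glue_pieces f n t = f k t.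
Proof.
elim: n k t => [|n IHn] k t match_f; first by rewrite leqn0 => /eqP ->.
rewrite leq_eqVlt => /predU1P [->|kn] /andP [kt tk] /=.
  case: ifP => [tn|//].
  have -> : t = n.+1%:R by apply/eqP; rewrite eq_le tn.
  rewrite -match_f // (IHn n) ?lexx ?ler_nat ?leqnSn // => i ilt.
  by apply: match_f; rewrite ltnW.
have -> : t <= n.+1%:R by rewrite (le_trans tk) ?ler_nat.
rewrite (IHn k) ?kt //.
by move=> i ilt; apply: match_f; rewrite ltnW.
Qed.

Lemma glue_pieces_C1 (R : realType) (f df : nat -> R -> R) (n : nat) :
  (forall k, (k <= n)%N -> has_C1_derivative (f k) (df k)) ->
  (forall k, (k < n)%N -> f k k.+1%:R = f k.+1 k.+1%:R) ->
  (forall k, (k < n)%N -> df k k.+1%:R = df k.+1 k.+1%:R) ->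
  has_C1_derivative (glue_pieces f n) (glue_pieces df n).
Proof.
elim: n => [|n IHn] C1f match_f match_df; first exact: C1f.
apply: (@glue_C1 _ (glue_pieces f n) (glue_pieces df n) (f n.+1) (df n.+1)).
- by apply: IHn => k kn; [apply: C1f | apply: match_f | apply: match_df];
    rewrite ltnW.
- exact: C1f.
- rewrite (@glue_pieces_on _ f n n) ?lexx ?ler_nat ?leqnSn ?match_f //.
  by move=> k kn; apply: match_f; rewrite ltnW.
- rewrite (@glue_pieces_on _ df n n) ?lexx ?ler_nat ?leqnSn ?match_df //.
  by move=> k kn; apply: match_df; rewrite ltnW.
Qed.

(** * Generic positions *)

(** Membership of [i] is the binary digit number [i] of the sum. [halve] splits off digit 0 and
    shifts the other exponents down, which is the induction step for [bit]. *)
Lemma sum_exp2_inj (s t : seq nat) : uniq s -> uniq t ->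
  (\sum_(i <- s) 2 ^ i = \sum_(i <- t) 2 ^ i)%N -> s =i t.
Proof.
have halve (r : seq nat) : uniq r ->
    (\sum_(j <- r) 2 ^ j =
     (0%N \in r) + (\sum_(j <- map predn [seq j <- r | 0 < j]) 2 ^ j).*2)%N.
  move=> r_uniq; rewrite (bigID (ltn 0)) /= addnC; congr (_ + _)%N.
    rewrite -(count_uniq_mem _ r_uniq) -sum1_count.
    by apply: eq_big => [j|[]//]; rewrite -leqNgt leqn0.
  rewrite big_map big_filter -muln2 big_distrl /=.
  by apply: eq_bigr => -[//|j] _; rewrite expnSr.
have bit (r : seq nat) i : uniq r ->
    (i \in r) = odd ((\sum_(j <- r) 2 ^ j) %/ 2 ^ i).
  elim: i r => [|i IHi] r r_uniq; rewrite (halve r) //.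
    by rewrite divn1 oddD odd_double addbF oddb.
  rewrite expnS divnMA divn2 half_bit_double -IHi.
    apply/idP/mapP => [ir|[[|j]]]; first by exists i.+1; rewrite ?mem_filter.
      by rewrite mem_filter.
    by rewrite mem_filter => /andP [_ jr] /= ->.
  rewrite map_inj_in_uniq ?filter_uniq // => -[|j] [|k] //;
    by rewrite !mem_filter => // _ _ /= ->.
by move=> us ut E i; rewrite !bit // E.
Qed.

(* The positions are [2 ^ (2 ^ rank)]: by uniqueness of binary expansions, equal
   sums of distinct products of them have the same terms.  The last condition says
   that the points [(a, b)], [(c, d)], [(e, f)] are not collinear. *)
Lemma generic_positions (R : realType) (T : finType) (g : T -> nat) :
  exists x : T -> R,
  [/\ forall a, 0 < x a,
      forall a b, (g a < g b)%N -> 2 * x a <= x b,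
      injective x,
      forall a b c d, uniq [:: a; b; c; d] -> x a + x b <> x c + x d
    & forall a b c d e f, uniq [:: a; b; c; d; e; f] ->
        x a * x d + x c * x f + x e * x b <> x c * x b + x e * x d + x a * x f].
Proof.
(* The group is the leading digit and the enumeration index the last one in base [#|T|], so [rank]
   is injective and respects the order of the groups. *)
pose rank (a : T) := (g a * #|T| + enum_rank a)%N.
have rank_inj : injective rank.
  move=> a b; rewrite /rank => E.
  have T0 : (0 < #|T|)%N by apply/card_gt0P; exists a.
  apply/enum_rank_inj/val_inj; move: (congr1 (modn^~ #|T|) E).
  by rewrite !modnMDl !modn_small.
pose y (a : T) := (2 ^ (2 ^ rank a))%N.
have rank_mono a b : (g a < g b)%N -> (rank a < rank b)%N.
  rewrite /rank => ab; apply: (@leq_trans ((g a).+1 * #|T|)%N).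
    by rewrite mulSn addnC ltn_add2r ltn_ord.
  by apply: (leq_trans _ (leq_addr _ _)); rewrite leq_mul2r ab orbT.
have exp_inj u v : (2 ^ rank u == 2 ^ rank v)%N = (u == v).
  by rewrite eqn_exp2l // (inj_eq rank_inj).
(* Binary uniqueness is used on two levels: here on the exponents of the products of two positions,
   then on the sums of these products. *)
have two_exp u v w z : u != v -> w != z ->
    (2 ^ rank u + 2 ^ rank v = 2 ^ rank w + 2 ^ rank z)%N -> (u == w) || (u == z).
  move=> uv wz E; have := @sum_exp2_inj [:: rank u; rank v] [:: rank w; rank z].
  rewrite !big_cons !big_nil !addn0 /= !inE !andbT !(inj_eq rank_inj).
  by move/(_ uv wz E (rank u)); rewrite !inE !(inj_eq rank_inj) eqxx.
have yM u v : (2 ^ (2 ^ rank u + 2 ^ rank v) = y u * y v)%N by rewrite expnD.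
exists (fun a => (y a)%:R); split.
- by move=> a; rewrite ltr0n expn_gt0.
- move=> a b /rank_mono ab; rewrite -natrM ler_nat /y -expnS leq_exp2l //.
  apply: (@leq_trans (2 ^ (rank a).+1)%N); last by rewrite leq_exp2l.
  by rewrite expnS; have := expn_gt0 2 (rank a); lia.
- move=> a b /eqP; rewrite eqr_nat => /eqP /(expnI (isT : 1 < 2)%N).
  by move/(expnI (isT : 1 < 2)%N)/rank_inj.
- move=> a b c d U /eqP; rewrite -!natrD eqr_nat => /eqP E.
  have := @sum_exp2_inj [:: 2 ^ rank a; 2 ^ rank b]%N [:: 2 ^ rank c; 2 ^ rank d]%N.
  rewrite !big_cons !big_nil !addn0 /= !inE !andbT !exp_inj => H.
  move: U; rewrite /= !inE !negb_or.
  move=> /and4P [/and3P [ab ac ad] _ cd _].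
  by move/(_ ab cd E (2 ^ rank a)%N): H; rewrite !inE !exp_inj eqxx (negPf ac) (negPf ad).
- move=> a b c d e f U /eqP; rewrite -!natrM -!natrD eqr_nat => /eqP E.
  have := @sum_exp2_inj
    [:: 2 ^ rank a + 2 ^ rank d; 2 ^ rank c + 2 ^ rank f; 2 ^ rank e + 2 ^ rank b]%N
    [:: 2 ^ rank c + 2 ^ rank b; 2 ^ rank e + 2 ^ rank d; 2 ^ rank a + 2 ^ rank f]%N.
  rewrite !big_cons !big_nil !addn0 !addnA !yM => /(_ _ _ E) H.
  have neq u v w z : u != v -> w != z -> u != w -> u != z ->
      (2 ^ rank u + 2 ^ rank v == 2 ^ rank w + 2 ^ rank z)%N = false.
    by move=> uv wz uw uz; apply/negP => /eqP /(two_exp _ _ _ _ uv wz);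
      rewrite (negPf uw) (negPf uz).
  (* [uniq] yields each inequality in one orientation only; the reversed list supplies the other.
     The product of [a] and [d] then has no equal on the right-hand side. *)
  move: {+}U; rewrite -rev_uniq; move: U; rewrite /= !inE !negb_or.
  move=> /and5P [/and5P [ab ac ad ae af] /and4P [bc bd be bf] /and3P [cd ce cf]
    /andP [de df] /andP [ef _]].
  move=> /and5P [/and5P [fe fd fc fb fa] /and4P [ed ec eb ea] /and3P [dc db da]
    /andP [cb ca] /andP [ba _]].
  move: H; rewrite /= !inE !negb_or !neq // => /(_ isT isT) /(_ (2 ^ rank a + 2 ^ rank d)%N).
  by rewrite !inE eqxx eqn_add2l exp_inj (negPf df) orbF !neq.
Qed.

(** * Combinatorics of Gauss codes *)

(* Ranks decrease along each cycle from a chosen root. *)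
Lemma perm_rank (T : finType) (s : {perm T}) : exists r : T -> nat,
  forall h k, k \in porbit s h -> k <> h -> k <> s h ->
    [\/ r k < r (s h) < r h, r (s h) < r h < r k | r h < r k < r (s h)]%N.
Proof.
pose idx h := findex s (froot s h) h.
have idx_max h : (idx h < fingraph.order s (froot s h))%N.
  by rewrite findex_max // (fconnect_sym (@perm_inj _ s)) connect_root.
(* The truncated subtraction is exact: an index is smaller than the length of its cycle, hence than
   [#|T|]. *)
exists (fun h => #|T| - idx h)%N => h k hk kh ksh.
have conn_sym := fconnect_sym (@perm_inj _ s).
have rk : froot s k = froot s h.
  apply/eqP; rewrite root_connect // conn_sym.
  by have /porbitP [i ->] := hk; rewrite permX fconnect_iter.
have rsh : froot s (s h) = froot s h.
  by apply/eqP; rewrite root_connect // conn_sym fconnect1.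
have iter_idx u : froot s u = froot s h -> iter (idx u) s (froot s h) = u.
  by move=> E; rewrite /idx -E iter_findex // conn_sym connect_root.
have Ih := iter_idx h erefl; have Ik := iter_idx k rk.
have Ish := iter_idx (s h) rsh.
have kh' : idx k <> idx h by move=> E; apply: kh; rewrite -Ik E.
have ksh' : idx k <> idx (s h) by move=> E; apply: ksh; rewrite -Ik E.
have := idx_max h; have := idx_max k; rewrite rk.
have := max_card (fconnect s (froot s h)).
rewrite -/(fingraph.order s (froot s h)).
(* The index grows by one along the cycle except at its last element, which returns to the root;
   this wrap-around produces the third alternative. *)
have Esh : idx (s h) = if ((idx h).+1 < fingraph.order s (froot s h))%N
                       then (idx h).+1 else 0%N.
  have Esh : s h = iter (idx h).+1 s (froot s h) by rewrite /= Ih.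
  rewrite {1}/idx rsh {1}Esh; case: ltnP => [|le_ord]; first exact: findex_iter.
  have <- : fingraph.order s (froot s h) = (idx h).+1.
    by apply/eqP; rewrite eqn_leq le_ord idx_max.
  by rewrite iter_order ?findex0 //; exact: perm_inj.
move: ksh'; rewrite Esh; case: ifP => lt_ord ksh' o1 o2 o3.
  case: (ltngtP (idx k) (idx h)) => [kh1|hk1|//];
    [apply: Or32|apply: Or31]; lia.
by apply: Or33; lia.
Qed.

(** Without a mate, the total number of occurrences of the symbol would be exactly 1, which
    [word_twice] excludes. *)
Lemma passage_mate (G : digraph) (A : eqType) (C : gauss_code G A)
    (e : edge G) (i : nat) (x : gauss_entry A) :
  onth (word C e) i = Some x ->
  exists f j y, [/\ onth (word C f) j = Some y, symbol y = symbol x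
                  & (e, i) <> (f, j)].
Proof.
move=> xi; apply: contrapT => no_mate.
have countE f : count (fun y => symbol y == symbol x) (word C f) =
    (\sum_(j < size (word C f)) (symbol (nth x (word C f) j) == symbol x))%N.
  rewrite -sum1_count (big_nth x) big_mkord big_mkcond.
  by apply: eq_bigr => j _; case: ifP.
have nthE f j : (j < size (word C f))%N ->
    onth (word C f) j = Some (nth x (word C f) j).
  by move=> jlt; rewrite onthE (nth_map x).
have other f j : (e, i) <> (f, j) -> (j < size (word C f))%N ->
    (symbol (nth x (word C f) j) == symbol x) = false.
  move=> neq jlt; apply/eqP => sx; apply: no_mate.
  by exists f, j, (nth x (word C f) j); split; rewrite // nthE.
have ilt : (i < size (word C e))%N by rewrite -onthTE xi.
have := word_twice C (symbol x); rewrite /occurrences (bigD1 e) //=.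
rewrite [X in (_ + X)%N]big1 => [|f /eqP fe].
  rewrite countE (bigD1 (Ordinal ilt)) //= (onth_nth x _ _ _ xi) eqxx big1 => [[]//|j ji].
  by rewrite other // => -[ij]; case/eqP: ji; apply/val_inj.
by rewrite countE big1 // => j _; rewrite other // => -[ef]; case: fe.
Qed.

(** * Profiles of the strands *)

(* [Fan] stands for the strands from the vertices to the ports. *)
Variant layer := Upper | Lower | Fan.

Section Profiles.
Variable R : realType.
Implicit Types (L : layer) (u v : R).

(* A strand from the node [a] to the node [b] is
   [u |-> (a + (b - a) * hprof L u, vprof L u)] on [0, 1].  The value [dhprof L 1 = 0]
   makes it vertical at a port, and [hprof Fan] is linear near 0 to make it
   straight at a vertex. *)
Definition hprof L u : R :=
  if L is Fan then if u <= 1 / 2 then 4 / 3 * u else 1 - 4 / 3 * (1 - u) ^+ 2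
  else u ^+ 2 * (3 - 2 * u).

(** For a linear part [c * u] followed by a parabola with apex (1, 1), C^1 matching at 1/2 forces
    [c = 4 / 3]. The cubic of the arcs is the Hermite interpolant from 0 to 1 with slope 0 at both
    ends. *)
Definition dhprof L u : R :=
  if L is Fan then if u <= 1 / 2 then 4 / 3 else 8 / 3 * (1 - u)
  else 6 * u * (1 - u).

Definition vprof L u : R :=
  match L with Upper => u * (1 - u) | Lower => - (u * (1 - u)) | Fan => u - 1 end.

Definition dvprof L u : R :=
  match L with Upper => 1 - 2 * u | Lower => 2 * u - 1 | Fan => 1 end.

Lemma horner_C1_eq (p : {poly R}) (f df : R -> R) :
  f =1 horner p -> df =1 horner p^`() -> has_C1_derivative f df.
Proof. by move=> /funext -> /funext ->; exact: horner_C1. Qed.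

Lemma hprof_C1 L : has_C1_derivative (hprof L) (dhprof L).
Proof.
have arc : has_C1_derivative (hprof Upper) (dhprof Upper).
  apply: (@horner_C1_eq ('X * 'X * (3%:P - 2%:P * 'X))) => u /=;
    rewrite ?poly.derivE !hornerE /=; ring.
case: L => //; apply: glue_C1; last 2 first.
- by field.
- by field.
- apply: (@horner_C1_eq ((4 / 3)%:P * 'X)) => u /=;
    rewrite ?poly.derivE !hornerE //=.
- apply: (@horner_C1_eq (1%:P - (4 / 3)%:P * ((1%:P - 'X) * (1%:P - 'X)))) => u /=;
    rewrite ?poly.derivE !hornerE /=; lra.
Qed.

Lemma vprof_C1 L : has_C1_derivative (vprof L) (dvprof L).
Proof.
case: L.
- apply: (@horner_C1_eq ('X * (1%:P - 'X))) => u /=;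
    rewrite ?poly.derivE !hornerE /=; ring.
- apply: (@horner_C1_eq (- ('X * (1%:P - 'X)))) => u /=;
    rewrite ?poly.derivE !hornerE /=; ring.
- by apply: (@horner_C1_eq ('X - 1%:P)) => u /=;
    rewrite ?poly.derivE !hornerE /= ?subr0.
Qed.

Lemma hprof0 L : hprof L 0 = 0.
Proof. by case: L => /=; rewrite ?divr_ge0 // ?expr0n /= ?mul0r ?mulr0. Qed.

Lemma hprof1 L : hprof L 1 = 1.
Proof. case: L => /=; try case: ifP => ?; lra. Qed.

Lemma hprof_flip L u : L <> Fan -> hprof L (1 - u) = 1 - hprof L u.
Proof. case: L => //= _; ring. Qed.

Lemma hprof_mono L u v : 0 <= u -> u < v -> v <= 1 -> hprof L u < hprof L v.
Proof.
have arc : 0 <= u -> u < v -> v <= 1 -> u ^+ 2 * (3 - 2 * u) < v ^+ 2 * (3 - 2 * v).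
  move=> u0 uv v1; rewrite -subr_gt0.
  have -> : v ^+ 2 * (3 - 2 * v) - u ^+ 2 * (3 - 2 * u) =
    (v - u) * (3 * (u * (1 - u)) + 3 * (v * (1 - v)) + (v - u) ^+ 2) by ring.
  have d0 : 0 < v - u by rewrite subr_gt0.
  rewrite mulr_gt0 // ltr_wpDl ?exprn_gt0 // addr_ge0 // mulr_ge0 // mulr_ge0 //;
    lra.
case: L => //= u0 uv v1; do 2 case: ifPn => ?; nra.
Qed.

Lemma hprof_inj L u v : 0 <= u <= 1 -> 0 <= v <= 1 -> hprof L u = hprof L v -> u = v.
Proof.
move=> /andP [u0 u1] /andP [v0 v1] E; case: (ltgtP u v) => // uv.
  by have := hprof_mono L u0 uv v1; rewrite E ltxx.
by have := hprof_mono L v0 uv u1; rewrite E ltxx.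
Qed.

Lemma hprof_bounds L u : 0 < u < 1 -> 0 < hprof L u < 1.
Proof.
move=> /andP [u0 u1]; rewrite -{1}(hprof0 L) -(hprof1 L).
by rewrite !hprof_mono // ltW.
Qed.

Lemma dhprof_gt0 L u : 0 < u < 1 -> 0 < dhprof L u.
Proof. by case: L => /= /andP [u0 u1]; try case: ifPn => ?; nra. Qed.

(** Turns a solution of the linear meeting equation, which is a value of the profile, back into a
    parameter in the first half of an arc. *)
Lemma arc_hprof_surj (l : R) : 0 < l < 1 / 2 ->
  exists2 u, 0 < u < 1 / 2 & hprof Lower u = l.
Proof.
move=> /andP [l0 l1].
pose p : {poly R} := 'X * 'X * (3%:P - 2%:P * 'X) - l%:P.
have pE u : p.[u] = hprof Lower u - l by rewrite !hornerE /=; ring.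
have [||u /andP [u0 u1] /rootP ru] := @poly_ivt _ p 0 (1 / 2).
- lra.
- by rewrite !pE /=; apply/andP; split; lra.
move: ru; rewrite pE => /eqP; rewrite subr_eq0 => /eqP E.
have u_neq0 : u != 0 by apply/eqP => u_eq; move: E; rewrite u_eq /=; lra.
have u_neq2 : u != 1 / 2 by apply/eqP => u_eq; move: E; rewrite u_eq /=; lra.
by exists u; rewrite // lt_neqAle eq_sym u_neq0 u0 lt_neqAle u_neq2 u1.
Qed.

End Profiles.

(** * The curve of an edge *)

Section Realization.
Variables (R : realType) (G : digraph) (A : eqType) (C : gauss_code G A).
Implicit Types (e f : edge G) (k l : nat) (u v t : R).

(* The curve of [e] at time [k] is at [node_at e k]; the piece number [k], on
   [k, k + 1], is an upper arc for [k] odd and passes the [i]-th symbol of the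
   word of [e] on a lower arc for [k = 2 i + 2].  The first and last pieces are
   attached to the vertices; the last one is a reversed strand. *)
Definition last_piece e : nat := (size (word C e)).*2.+2.

(** Vertices and ports form a single finite type, so that one generic choice places them all; the
    ordinal bound is uniform in the edge to avoid dependent pairs. *)
Definition node : finType :=
  (vertex G + edge G * 'I_(\max_(e : edge G) last_piece e).+1)%type.

Definition node_at e k : node :=
  if k == 0%N then inl (source e)
  else if k == (last_piece e).+1 then inl (target e) else inr (e, inord k).

Definition piece_layer e k : layer :=
  if (k == 0%N) || (k == last_piece e) then Fan
  else if odd k then Upper else Lower.

Definition piece_rev e k : bool := k == last_piece e.

Definition piece_start e k : node := node_at e (if piece_rev e k then k.+1 else k).
Definition piece_stop e k : node := node_at e (if piece_rev e k then k else k.+1).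
Definition piece_param e k u : R := if piece_rev e k then 1 - u else u.
Definition piece_sign e k : R := if piece_rev e k then -1 else 1.
Definition piece_shift e k : R := if piece_rev e k then k.+1%:R else - k%:R.

Lemma portE e k : (0 < k <= last_piece e)%N -> node_at e k = inr (e, inord k).
Proof.
by move=> /andP [k0 kl]; rewrite /node_at; case: ifP => [|_]; [lia|case: ifP => //; lia].
Qed.

Lemma node_at_inj e f k l :
  (0 < k <= last_piece e)%N -> (0 < l <= last_piece f)%N ->
  node_at e k = node_at f l -> (e, k) = (f, l).
Proof.
move=> ke lf; rewrite !portE // => -[-> /(congr1 val)] /=.
have bound g m : (0 < m <= last_piece g)%N ->
    (m < (\max_(e : edge G) last_piece e).+1)%N.
  by move=> /andP [_ /leq_trans]; apply; exact: leq_bigmax.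
by rewrite (inordK (bound _ _ ke)) (inordK (bound _ _ lf)) => ->.
Qed.

Variable pos : node -> R.

Definition strand_point L (a b : node) u : R * R :=
  (pos a + (pos b - pos a) * hprof L u, vprof L u).

Definition strand_velocity L (a b : node) u : R * R :=
  ((pos b - pos a) * dhprof L u, dvprof L u).

Definition piece_point e k u : R * R :=
  strand_point (piece_layer e k) (piece_start e k) (piece_stop e k)
    (piece_param e k u).

Definition piece_velocity e k u : R * R :=
  let w := strand_velocity (piece_layer e k) (piece_start e k) (piece_stop e k)
             (piece_param e k u) in
  (piece_sign e k * w.1, piece_sign e k * w.2).

(** The shape [a + b * f (c * t + d)], kept even for trivial coefficients in [piece_y], is the one
    that [affine_comp_C1] differentiates. *)
Definition piece_x e k t : R :=
  pos (piece_start e k) + (pos (piece_stop e k) - pos (piece_start e k)) *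
    hprof (piece_layer e k) (piece_sign e k * t + piece_shift e k).

Definition piece_y e k t : R :=
  0 + 1 * vprof (piece_layer e k) (piece_sign e k * t + piece_shift e k).

Definition piece_dx e k t : R :=
  (pos (piece_stop e k) - pos (piece_start e k)) *
    (piece_sign e k *
     dhprof (piece_layer e k) (piece_sign e k * t + piece_shift e k)).

Definition piece_dy e k t : R :=
  1 * (piece_sign e k *
       dvprof (piece_layer e k) (piece_sign e k * t + piece_shift e k)).

Lemma piece_paramE e k u :
  piece_sign e k * (k%:R + u) + piece_shift e k = piece_param e k u.
Proof.
rewrite /piece_sign /piece_shift /piece_param; case: ifP => _; last by ring.
by rewrite -natr1; ring.
Qed.

Lemma piece_xy e k u : (piece_x e k (k%:R + u), piece_y e k (k%:R + u)) =
  piece_point e k u.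
Proof.
by rewrite /piece_x /piece_y piece_paramE add0r mul1r.
Qed.

Lemma piece_dxy e k u : (piece_dx e k (k%:R + u), piece_dy e k (k%:R + u)) =
  piece_velocity e k u.
Proof.
by rewrite /piece_dx /piece_dy piece_paramE mul1r mulrCA.
Qed.

(** The horizontal profile is stationary at a port and the vertical speed depends only on the parity
    of [k], so the positions drop out of the velocity. The next piece is shown to start with the
    same data. *)
Lemma piece_point_stop e k : (k < last_piece e)%N ->
  piece_point e k 1 = (pos (node_at e k.+1), 0) /\
  piece_velocity e k 1 = (0, (-1) ^+ k).
Proof.
move=> kl; rewrite /piece_point /piece_velocity /piece_param /piece_start
  /piece_stop /piece_sign /strand_point /strand_velocity.
have -> : piece_rev e k = false by rewrite /piece_rev ltn_eqF.
rewrite hprof1 !mul1r mulr1 subrKC.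
have -> : dhprof (piece_layer e k) 1 = 0 :> R.
  by case: piece_layer => /=; try case: ifP => ?; lra.
rewrite mulr0 /piece_layer (ltn_eqF kl) orbF -signr_odd.
case: k kl => [|k] kl /=; first by rewrite subrr expr0.
case: (odd k) => /=; rewrite ?expr0 ?expr1; split; congr (_, _); lra.
Qed.

Lemma piece_point_start e k : (k < last_piece e)%N ->
  piece_point e k.+1 0 = (pos (node_at e k.+1), 0) /\
  piece_velocity e k.+1 0 = (0, (-1) ^+ k).
Proof.
rewrite leq_eqVlt => /predU1P [kl|kl].
  rewrite /piece_point /piece_velocity /piece_param /piece_start
    /piece_stop /piece_sign /strand_point /strand_velocity.
  have -> : piece_rev e k.+1 by rewrite /piece_rev kl.
  rewrite /piece_layer kl eqxx orbT subr0 hprof1 mulr1 subrKC /=.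
  rewrite -signr_odd.
  (* The last piece has an even number, so the reversed strand runs downwards, as the sign
     [(-1) ^+ k] requires. *)
  have -> : odd k by move: kl; rewrite /last_piece; lia.
  by case: ifP => ?; split; congr (_, _); lra.
rewrite /piece_point /piece_velocity /piece_param /piece_start
  /piece_stop /piece_sign /strand_point /strand_velocity.
have -> : piece_rev e k.+1 = false by rewrite /piece_rev ltn_eqF.
rewrite hprof0 /piece_layer (ltn_eqF kl) /= mulr0 addr0 -signr_odd.
by case: (odd k) => /=; rewrite ?expr0 ?expr1; split; congr (_, _); lra.
Qed.

Definition path_length e : R := (last_piece e).+1%:R.

Definition path_curve e t : R * R :=
  (glue_pieces (piece_x e) (last_piece e) (path_length e * t),
   glue_pieces (piece_y e) (last_piece e) (path_length e * t)).

Lemma path_length_gt0 e : 0 < path_length e.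
Proof. by rewrite ltr0n. Qed.

Lemma piece_match e k : (k < last_piece e)%N ->
  [/\ piece_x e k k.+1%:R = piece_x e k.+1 k.+1%:R,
      piece_y e k k.+1%:R = piece_y e k.+1 k.+1%:R,
      piece_dx e k k.+1%:R = piece_dx e k.+1 k.+1%:R
    & piece_dy e k k.+1%:R = piece_dy e k.+1 k.+1%:R].
Proof.
move=> kl; have [P1 V1] := piece_point_stop kl; have [P0 V0] := piece_point_start kl.
have := piece_xy e k 1; have := piece_dxy e k 1; rewrite natr1 P1 V1.
have := piece_xy e k.+1 0; have := piece_dxy e k.+1 0; rewrite addr0 P0 V0.
by move=> [-> ->] [-> ->] [-> ->] [-> ->].
Qed.

Lemma path_C1 e :
  has_C1_derivative (fun t => (path_curve e t).1)
    (fun t => path_length e * glue_pieces (piece_dx e) (last_piece e) (path_length e * t)) /\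
  has_C1_derivative (fun t => (path_curve e t).2)
    (fun t => path_length e * glue_pieces (piece_dy e) (last_piece e) (path_length e * t)).
Proof.
have scale (f df : R -> R) c : has_C1_derivative f df ->
    has_C1_derivative (fun t => f (c * t)) (fun t => c * df (c * t)).
  move=> /(@affine_comp_C1 _ _ _ 0 1 c 0).
  rewrite (_ : (fun t => 0 + 1 * f (c * t + 0)) = (fun t => f (c * t))); last first.
    by apply/funext => t; rewrite add0r mul1r addr0.
  rewrite (_ : (fun t => 1 * (c * df (c * t + 0))) = (fun t => c * df (c * t))) //.
  by apply/funext => t; rewrite mul1r addr0.
split; apply: scale; apply: glue_pieces_C1 => k kl.
- exact: (affine_comp_C1 _ _ _ _ (hprof_C1 R (piece_layer e k))).
- by have [] := piece_match kl.
- by have [] := piece_match kl.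
- exact: (affine_comp_C1 _ _ _ _ (vprof_C1 R (piece_layer e k))).
- by have [] := piece_match kl.
- by have [] := piece_match kl.
Qed.

Lemma path_velocity e t : velocity (path_curve e) t =
  (path_length e * glue_pieces (piece_dx e) (last_piece e) (path_length e * t),
   path_length e * glue_pieces (piece_dy e) (last_piece e) (path_length e * t)).
Proof.
have [[Dx _] [Dy _]] := path_C1 e.
by rewrite /velocity !derive1E; have [_ ->] := Dx t; have [_ ->] := Dy t.
Qed.

Lemma path_C1_curve e : C1_curve (path_curve e).
Proof.
have [[Dx Cx] [Dy Cy]] := path_C1 e; split.
- by move=> t; have [] := Dx t.
- by move=> t; have [] := Dy t.
- by rewrite (funext (fun t => congr1 fst (path_velocity e t))).
- by rewrite (funext (fun t => congr1 snd (path_velocity e t))).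
Qed.

Definition time e k u : R := (k%:R + u) / path_length e.

Lemma path_lengthK e k u : path_length e * time e k u = k%:R + u.
Proof. by rewrite mulrC divfK // gt_eqF // path_length_gt0. Qed.

Lemma path_time e k u : (k <= last_piece e)%N -> 0 <= u <= 1 ->
  path_curve e (time e k u) = piece_point e k u /\
  velocity (path_curve e) (time e k u) =
    (path_length e * (piece_velocity e k u).1, path_length e * (piece_velocity e k u).2).
Proof.
move=> kl u01; rewrite path_velocity /path_curve path_lengthK -piece_xy -piece_dxy.
have ku : k%:R <= k%:R + u <= k.+1%:R by rewrite -natr1 lerDl lerD2l.
by rewrite !(glue_pieces_on _ kl ku) // => l /piece_match [].
Qed.

Lemma time_of e t : 0 <= t < 1 ->
  exists k u, [/\ (k <= last_piece e)%N, 0 <= u < 1 & t = time e k u].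
Proof.
move=> /andP [t0 t1]; have L0 := path_length_gt0 e.
have T0 : 0 <= path_length e * t by rewrite mulr_ge0 // ltW.
have /andP [k1 k2] := Num.Theory.truncn_itv T0.
set k := Num.truncn _ in k1 k2.
exists k, (path_length e * t - k%:R); split.
- rewrite -ltnS -(ltr_nat R); apply: le_lt_trans k1 _.
  by rewrite -[ltRHS]mulr1 ltr_pM2l.
- by rewrite subr_ge0 k1 /= ltrBlDl natr1.
- by rewrite /time subrKC mulrAC divff ?mul1r // gt_eqF.
Qed.
End Realization.

(** * Double points *)

Lemma lt01W (R : numDomainType) (v : R) : 0 < v < 1 -> 0 <= v <= 1.
Proof. by case/andP => v0 v1; rewrite !ltW. Qed.

Lemma half01 (R : realFieldType) : (0 < 1 / 2 :> R) && (1 / 2 < 1 :> R).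
Proof. by apply/andP; split; lra. Qed.

Lemma half_flip (R : realFieldType) : 1 - 1 / 2 = 1 / 2 :> R.
Proof. lra. Qed.

(** Applied to an arc and its own reversal, which can agree only halfway. *)
Lemma balanced_half (R : realFieldType) (x y l : R) : x <> y ->
  (x - y) * (1 - l) + (y - x) * l = 0 -> l = 1 / 2.
Proof.
move=> /eqP xy E; have : (x - y) * (1 - 2 * l) = 0 by rewrite -E; ring.
by move/eqP; rewrite mulf_eq0 subr_eq0 (negPf xy) /= => /eqP; lra.
Qed.

Lemma uniq4_swap (T : eqType) (a b c d : T) : uniq [:: a; b; c; d] ->
  [/\ uniq [:: b; a; c; d], uniq [:: a; b; d; c], uniq [:: b; a; d; c]
    & uniq [:: b; c; d; a]].
Proof.
have eqU (r s : seq T) : (forall p, count p r = count p s) -> uniq s -> uniq r.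
  by move=> rs; rewrite (@perm_uniq _ r s) //; apply/seq.permP.
by move=> U; split; apply: eqU U => p /=; lia.
Qed.

Section Incidences.
Variables (R : realType) (G : digraph) (A : eqType) (C : gauss_code G A).
Variable pos : node C -> R.
Implicit Types (e f : edge G) (k l : nat) (u v t : R) (a b c d : node C).

(** The second clause serves transversality, the third excludes triple points, and the last
    separates vertex strands from lower arcs, the only distinct layers whose heights overlap. *)
Definition generic_layout : Prop :=
  [/\ injective pos,
      forall a b c d, uniq [:: a; b; c; d] -> pos a + pos b <> pos c + pos d,
      forall a b c d a' b', uniq [:: a; b; c; d; a'; b'] ->
        pos a * pos d + pos c * pos b' + pos a' * pos b <>
        pos c * pos b + pos a' * pos d + pos a * pos b'
    & forall e k f l a b,
        (k <= last_piece C e)%N -> (l <= last_piece C f)%N ->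
        piece_layer C e k = Fan -> piece_layer C f l = Lower ->
        a \in [:: piece_start C e k; piece_stop C e k] ->
        b \in [:: piece_start C f l; piece_stop C f l] -> pos b < pos a].

Hypothesis pos_generic : generic_layout.

Let pos_inj := let: And4 H _ _ _ := pos_generic in H.
Let pos_sum := let: And4 _ H _ _ := pos_generic in H.
Let pos_det := let: And4 _ _ H _ := pos_generic in H.
Let pos_sep := let: And4 _ _ _ H := pos_generic in H.

Lemma fan_nodes e k : (k <= last_piece C e)%N -> piece_layer C e k = Fan ->
  exists (x : vertex G) j, [/\ piece_start C e k = inl x, piece_stop C e k = node_at C e j,
    (0 < j <= last_piece C e)%N & j = if k == 0%N then 1%N else last_piece C e].
Proof.
rewrite /piece_layer /piece_start /piece_stop /piece_rev => kl.
case: (k =P 0%N) => [-> _|k0] /=.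
  by exists (source e), 1%N; rewrite /node_at eqxx.
case: (k =P last_piece C e) => [->|_]; last by case: ifP.
move=> _; exists (target e), (last_piece C e).
by rewrite {1}/node_at eqxx /=; split=> //; rewrite leqnn.
Qed.

Lemma arc_nodes e k : (k <= last_piece C e)%N -> piece_layer C e k <> Fan ->
  [/\ (0 < k)%N, (k < last_piece C e)%N, piece_start C e k = node_at C e k,
      piece_stop C e k = node_at C e k.+1 & piece_rev C e k = false].
Proof.
rewrite /piece_layer /piece_start /piece_stop /piece_rev leq_eqVlt.
case: (k =P 0%N) => [-> //|k0] /=; case: (k =P last_piece C e) => //= kl klt _.
by split=> //; rewrite lt0n; apply/eqP.
Qed.

Lemma arc_layer_odd e f k l :
  (k <= last_piece C e)%N -> (l <= last_piece C f)%N ->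
  piece_layer C e k <> Fan -> piece_layer C e k = piece_layer C f l -> odd k = odd l.
Proof.
move=> _ _; rewrite /piece_layer; case: ifP => [_ []//|_ _].
by case: (_ || _); case: (odd k); case: (odd l).
Qed.

Lemma strand_flip L a b v : L <> Fan ->
  strand_point pos L a b v = strand_point pos L b a (1 - v) /\
  strand_velocity pos L a b v =
    (-1 * (strand_velocity pos L b a (1 - v)).1,
     -1 * (strand_velocity pos L b a (1 - v)).2).
Proof.
move=> LF; rewrite /strand_point /strand_velocity hprof_flip //; split.
  by case: L LF => //= _; congr (_, _); ring.
by case: L LF => //= _; congr (_, _); ring.
Qed.

(* By the symmetry of the arcs, the second half of an arc is the first half
   of the reversed arc. *)
Definition on_strand e t L a b v (w : R) : Prop :=
  exists k u, [/\ [/\ (k <= last_piece C e)%N, 0 < u < 1, t = time C e k u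
                    & L = piece_layer C e k],
    (a = piece_start C e k /\ b = piece_stop C e k /\ v = piece_param C e k u) \/
    (L <> Fan /\ a = piece_stop C e k /\ b = piece_start C e k /\ v = 1 - piece_param C e k u),
    0 < v < 1, (L <> Fan -> v <= 1 / 2)
  & [/\ path_curve pos e t = strand_point pos L a b v,
        velocity (path_curve pos e) t =
          (w * (strand_velocity pos L a b v).1, w * (strand_velocity pos L a b v).2)
      & w != 0]].

Lemma piece_param01 e k u : 0 < u < 1 -> 0 < piece_param C e k u < 1.
Proof. by rewrite /piece_param; case: ifP => _ /andP [u0 u1]; apply/andP; split; lra. Qed.

Lemma on_strandP e k u : (k <= last_piece C e)%N -> 0 < u < 1 ->
  exists a b v w, on_strand e (time C e k u) (piece_layer C e k) a b v w.
Proof.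
move=> kl u01; have p01 := piece_param01 e k u01.
have u01' : 0 <= u <= 1 by case/andP: u01 => *; apply/andP; split; lra.
have [P V] := @path_time _ _ _ C pos e k u kl u01'.
set L := piece_layer C e k; set v := piece_param C e k u in p01.
have L0 := path_length_gt0 R C e.
have s0 : path_length R C e * piece_sign R C e k != 0.
  by rewrite mulf_neq0 ?(gt_eqF L0) //= /piece_sign; case: ifP => _;
    rewrite ?oppr_eq0 oner_eq0.
have [half|half] : (L <> Fan -> v <= 1 / 2) \/ (L <> Fan /\ 1 / 2 < v).
  case: (ltP (1 / 2) v) => [v2|v2]; last by left.
  by case: (L) => //; [right|right|left].
- exists (piece_start C e k), (piece_stop C e k), v,
    (path_length R C e * piece_sign R C e k), k, u; split=> //; first by left.
  by split=> //; rewrite V /piece_velocity /= -!mulrA.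
- have [LF v2] := half.
  exists (piece_stop C e k), (piece_start C e k), (1 - v),
    (- (path_length R C e * piece_sign R C e k)), k, u; split=> //.
  + by right.
  + by case/andP: p01 => *; apply/andP; split; lra.
  + by move=> _; lra.
  have [FP FV] := strand_flip (piece_start C e k) (piece_stop C e k) v LF.
  split; first by rewrite P /piece_point FP.
    by rewrite V /piece_velocity FV /=; congr (_, _); ring.
  by rewrite oppr_eq0.
Qed.

Lemma strand_nodes e t L a b v w : on_strand e t L a b v w ->
  exists k, [/\ (k <= last_piece C e)%N, L = piece_layer C e k,
    a \in [:: piece_start C e k; piece_stop C e k]
  & b \in [:: piece_start C e k; piece_stop C e k]].
Proof.
move=> [k [u [[kl u01 _ LE] nodes _ _ _]]]; exists k; split=> //.
  by case: nodes => [[-> _]|[_ [-> _]]]; rewrite !inE eqxx ?orbT.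
by case: nodes => [[_ [-> _]]|[_ [_ [-> _]]]]; rewrite !inE eqxx ?orbT.
Qed.

Lemma lt_conv (x y z w l m : R) : 0 < l < 1 -> 0 < m < 1 ->
  z < x -> z < y -> w < x -> w < y -> z + (w - z) * m < x + (y - x) * l.
Proof.
move=> /andP [l0 l1] /andP [m0 m1] zx zy wx wy.
apply: (@le_lt_trans _ _ (Num.max z w)).
  by case: (ltP z w) => zw; nra.
have : Num.max z w < x by case: (ltP z w).
have : Num.max z w < y by case: (ltP z w).
by set M := Num.max z w; nra.
Qed.

Lemma vprof_layer L L' (v v' : R) : 0 < v < 1 -> 0 < v' < 1 ->
  vprof L v = vprof L' v' ->
  [\/ L = L', L = Lower /\ L' = Fan | L = Fan /\ L' = Lower].
Proof.
move=> /andP [v0 v1] /andP [v0' v1'].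
by case: L; case: L' => /= E; try (by apply: Or31); try (by apply: Or32);
  try (by apply: Or33); exfalso; nra.
Qed.

Lemma vprof_inj L (v v' : R) : 0 < v < 1 -> 0 < v' < 1 ->
  (L <> Fan -> v <= 1 / 2) -> (L <> Fan -> v' <= 1 / 2) ->
  vprof L v = vprof L v' -> v = v'.
Proof.
move=> /andP [v0 v1] /andP [v0' v1'].
have arc : v <= 1 / 2 -> v' <= 1 / 2 -> v * (1 - v) = v' * (1 - v') -> v = v'.
  by move=> h h' E; nra.
case: L => /= h h' E; last by clear h h'; lra.
- by apply: arc; [apply: h | apply: h' |].
- by apply: arc; [apply: h | apply: h' | exact: oppr_inj].
Qed.

(** Equal heights force equal layers, up to the overlap of [Fan] and [Lower] that horizontal
    separation excludes. Within a layer they force equal parameters, since arcs are restricted to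
    their first halves. Equality of abscissas is then the linear equation. *)
Lemma strand_meet_layer e t f u L L' a b c d v v' w w' :
  on_strand e t L a b v w -> on_strand f u L' c d v' w' ->
  path_curve pos e t = path_curve pos f u ->
  [/\ L = L', v = v' &
     (pos a - pos c) * (1 - hprof L v) + (pos b - pos d) * hprof L v = 0].
Proof.
move=> He Hf.
have [k [ke Lk ak bk]] := strand_nodes He.
have [l [lf Ll cl dl]] := strand_nodes Hf.
have [_ [_ [_ _ v01 vhalf [-> _ _]]]] := He.
have [_ [_ [_ _ v01' vhalf' [-> _ _]]]] := Hf.
rewrite /strand_point => -[Ex Ey].
have h01 := hprof_bounds L v01.
have h01' := hprof_bounds L' v01'.
have Lower_Fan : ~ (L = Fan /\ L' = Lower).
  move=> [LF LL]; rewrite LF in Lk; rewrite LL in Ll.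
  have ca := pos_sep ke lf (esym Lk) (esym Ll) ak cl.
  have da := pos_sep ke lf (esym Lk) (esym Ll) ak dl.
  have cb := pos_sep ke lf (esym Lk) (esym Ll) bk cl.
  have db := pos_sep ke lf (esym Lk) (esym Ll) bk dl.
  by have := lt_conv h01 h01' ca cb da db; rewrite Ex ltxx.
have Fan_Lower : ~ (L = Lower /\ L' = Fan).
  move=> [LL LF]; rewrite LF in Ll; rewrite LL in Lk.
  have ca := pos_sep lf ke (esym Ll) (esym Lk) cl ak.
  have da := pos_sep lf ke (esym Ll) (esym Lk) dl ak.
  have cb := pos_sep lf ke (esym Ll) (esym Lk) cl bk.
  have db := pos_sep lf ke (esym Ll) (esym Lk) dl bk.
  by have := lt_conv h01' h01 ca da cb db; rewrite Ex ltxx.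
have LL' : L = L'.
  by case: (vprof_layer v01 v01' Ey).
move: Ex Ey vhalf'; rewrite -LL' => Ex Ey vhalf'.
have vv' := vprof_inj v01 v01' vhalf vhalf' Ey.
subst v'; split=> //; move: Ex; clear; lra.
Qed.

Lemma piece_param_inj e k : injective (@piece_param R G A C e k).
Proof. by move=> u v; rewrite /piece_param; case: ifP => _ E; lra. Qed.

Lemma piece_nodes_neq e k : (k <= last_piece C e)%N ->
  piece_start C e k <> piece_stop C e k.
Proof.
move=> ke; case: (pselect (piece_layer C e k = Fan)) => LF.
  by have [x [j [-> -> je _]]] := fan_nodes ke LF; rewrite portE.
have [k0 kl -> -> _] := arc_nodes ke LF.
by move/node_at_inj; rewrite k0 ltnW //= => /(_ isT kl) [] /n_Sn.
Qed.

Lemma hprof_half L : L <> Fan -> hprof L (1 / 2) = 1 / 2 :> R.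
Proof. by case: L => //= _; lra. Qed.

(** A piece is injective and meets its own reversal only halfway, so two different pieces are
    involved. Two vertex strands have different ports, and if they shared a vertex they could meet
    only there, at [h = 0]. *)
Lemma strand_meet e t f u L L' a b c d v v' w w' :
  on_strand e t L a b v w -> on_strand f u L' c d v' w' ->
  (e, t) <> (f, u) -> path_curve pos e t = path_curve pos f u ->
  uniq [:: a; b; c; d].
Proof.
move=> He Hf neq E; have [LL' vv' lin] := strand_meet_layer He Hf E.
subst L' v'.
have [k [u0 [[ke u001 tE Lk] nodes v01 _ _]]] := He.
have [l [u1 [[lf u101 uE Ll] nodes' _ _ _]]] := Hf.
have h01 := hprof_bounds L v01.
have piece_neq : (e, k) <> (f, l).
  move=> [ef kl]; subst f l.
  have u01 : u0 <> u1 by move=> u01; apply: neq; rewrite tE uE u01.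
  have swap x y : L <> Fan -> pos x <> pos y ->
      (pos x - pos y) * (1 - hprof L v) + (pos y - pos x) * hprof L v = 0 ->
      1 - v = v.
    move=> LF xy /(balanced_half xy) hv.
    have -> : v = 1 / 2.
      apply: (@hprof_inj _ L); first exact: lt01W.
        exact/lt01W/half01.
      by rewrite hprof_half.
    exact: half_flip.
  have st := piece_nodes_neq ke.
  apply: u01; apply: (@piece_param_inj e k).
  case: nodes nodes' => [[aE [bE vE]]|[LF [aE [bE vE]]]] [[cE [dE vE']]|[LF' [cE [dE vE']]]].
  - by rewrite -vE -vE'.
  - have -> : piece_param C e k u1 = 1 - v by rewrite vE' subKr.
    rewrite -vE (swap (piece_start C e k) (piece_stop C e k)) ?bE ?cE ?dE //.
      by move/pos_inj.
    by move: lin; rewrite aE bE cE dE.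
  - have -> : piece_param C e k u0 = 1 - v by rewrite vE subKr.
    rewrite -vE' (swap (piece_stop C e k) (piece_start C e k)) //.
      by move/pos_inj/esym.
    by move: lin; rewrite aE bE cE dE.
  - by apply: oppr_inj; apply: (addrI 1); rewrite -vE -vE'.
case: (pselect (L = Fan)) => LF.
  case: nodes => [[aE [bE _]]|[]//]; case: nodes' => [[cE [dE _]]|[]//].
  have LkF : piece_layer C e k = Fan by rewrite -Lk.
  have LlF : piece_layer C f l = Fan by rewrite -Ll.
  have [x [j [ax bj je jE]]] := fan_nodes ke LkF.
  have [y [i [cy di ie iE]]] := fan_nodes lf LlF.
  have bd : b <> d.
    rewrite bE dE bj di => /(node_at_inj je ie) [ef ji]; subst f; apply: piece_neq.
    move: LkF LlF ji; rewrite jE iE /piece_layer.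
    by case: (k =P 0%N) => [->|k0]; case: (l =P 0%N) => [->|l0] //=;
      case: (k =P last_piece C e) => [->|k1] //=; try (by case: ifP);
      case: (l =P last_piece C e) => [->|l1] //=; try (by case: ifP).
  have ac : a <> c.
    move=> ac; apply: bd; apply: pos_inj; move: lin; rewrite ac subrr mul0r add0r.
    move/eqP; rewrite mulf_eq0 subr_eq0 => /orP [/eqP //|/eqP h0].
    by move: h01; rewrite h0 ltxx.
  move/eqP/negPf: ac => ac; move/eqP/negPf: bd => bd.
  have inlr (z : vertex G) g m : (0 < m <= last_piece C g)%N ->
      ((inl z == node_at C g m) = false) * ((node_at C g m == inl z) = false).
    by move=> gm; rewrite portE.
  rewrite /= !inE ac bd aE bE cE dE ax bj cy di !inlr //.
have LkF : piece_layer C e k <> Fan by rewrite -Lk.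
have LlF : piece_layer C f l <> Fan by rewrite -Ll.
have [k0 kl sk tk _] := arc_nodes ke LkF.
have [l0 ll sl tl _] := arc_nodes lf LlF.
(* Arcs of one layer have numbers of equal parity, so two different ones on the same edge are not
   consecutive and share no port. *)
have odd_kl := arc_layer_odd ke lf LkF (etrans (esym Lk) Ll).
have U : uniq [:: node_at C e k; node_at C e k.+1; node_at C f l; node_at C f l.+1].
  have inj g m h i : (0 < m <= last_piece C g)%N -> (0 < i <= last_piece C h)%N ->
      (g, m) <> (h, i) -> (node_at C g m == node_at C h i) = false.
    by move=> gm hi gh; apply/eqP => /(node_at_inj gm hi).
  have neq_odd g m h i : odd m != odd i -> (g, m) <> (h, i) :> edge G * nat.
    by move=> + [_ mi]; rewrite mi eqxx.
  rewrite /= !inE !inj //= ?k0 ?l0 ?(ltnW kl) ?(ltnW ll) //=;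
    try (by apply: neq_odd; rewrite /= ?odd_kl; case: odd).
  by move=> [ef klE]; apply: piece_neq; rewrite ef klE.
have [U1 U2 U3 _] := uniq4_swap U.
by case: nodes nodes' => [[-> [-> _]]|[_ [-> [-> _]]]] [[-> [-> _]]|[_ [-> [-> _]]]];
  rewrite sk tk sl tl.
Qed.

Lemma dvprof_neq0 L (v : R) : 0 < v < 1 -> v <> 1 / 2 -> dvprof L v != 0.
Proof.
move=> _ v2; case: L => /=; rewrite ?oner_eq0 //; apply/eqP => E; apply: v2; lra.
Qed.

(** The determinant is a product containing the difference of the widths [pos b - pos a] and
    [pos d - pos c], nonzero by the sum condition. The factor [dvprof] vanishes only at the midpoint
    of an arc, where the meeting equation would read a + b = c + d. *)
Lemma strand_transverse e t f u L L' a b c d v v' w w' :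
  on_strand e t L a b v w -> on_strand f u L' c d v' w' ->
  (e, t) <> (f, u) -> path_curve pos e t = path_curve pos f u ->
  det2 (velocity (path_curve pos e) t) (velocity (path_curve pos f) u) <> 0.
Proof.
move=> He Hf neq E; have [LL' vv' lin] := strand_meet_layer He Hf E.
have U := strand_meet He Hf neq E; have [_ _ _ U'] := uniq4_swap U.
subst L' v'.
have [_ [_ [_ _ v01 _ [_ -> w0]]]] := He.
have [_ [_ [_ _ _ _ [_ -> w0']]]] := Hf.
have slope : pos b - pos a - (pos d - pos c) != 0.
  apply/eqP => S; apply: (pos_sum U'); move: S => /eqP.
  by rewrite subr_eq0 => /eqP S; apply/eqP; rewrite -subr_eq0; apply/eqP; lra.
have dv0 : dvprof L v != 0.
  case: (pselect (L = Fan)) => [->|LF]; first by rewrite oner_eq0.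
  apply: dvprof_neq0 => // v2; apply: (pos_sum U); move: lin.
  rewrite v2 hprof_half //; lra.
have dh0 : dhprof L v != 0 by rewrite gt_eqF // dhprof_gt0.
rewrite /det2 /=; apply/eqP.
have -> : w * ((pos b - pos a) * dhprof L v) * (w' * dvprof L v) -
   w * dvprof L v * (w' * ((pos d - pos c) * dhprof L v)) =
   w * w' * dhprof L v * dvprof L v * (pos b - pos a - (pos d - pos c)) by ring.
by rewrite !mulf_neq0.
Qed.

(** At a common point the three pairs of end positions lie on one line (1 - h)X + hY = const.
    Eliminating [1 - h] leaves [h] times the determinant that [pos_det] keeps nonzero. *)
Lemma strand_no_triple e t f u g s L L' L'' a b c d a' b' v v' v'' w w' w'' :
  on_strand e t L a b v w -> on_strand f u L' c d v' w' ->
  on_strand g s L'' a' b' v'' w'' ->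
  (e, t) <> (f, u) -> (e, t) <> (g, s) ->
  path_curve pos e t = path_curve pos f u ->
  path_curve pos e t = path_curve pos g s ->
  (f, u) = (g, s).
Proof.
move=> He Hf Hg ef eg Ef Eg; apply: contrapT => fg.
have [LL' vv' lin1] := strand_meet_layer He Hf Ef.
have [LL'' vv'' lin2] := strand_meet_layer He Hg Eg.
have U1 := strand_meet He Hf ef Ef.
have U2 := strand_meet He Hg eg Eg.
have U3 := strand_meet Hf Hg fg (etrans (esym Ef) Eg).
have U : uniq [:: a; b; c; d; a'; b'].
  move: U1 U2 U3; rewrite /= !inE !negb_or.
  move=> /and4P [/and3P [-> -> ->] /andP [-> ->] -> _].
  move=> /and4P [/and3P [_ -> ->] /andP [-> ->] -> _].
  by move=> /and4P [/and3P [_ -> ->] /andP [-> ->] _ _].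
apply: (pos_det U).
have [_ [_ [_ _ v01 _ _]]] := He.
have /andP [h0 _] := hprof_bounds L v01.
apply: (mulfI (lt0r_neq0 h0)); apply/eqP; rewrite -subr_eq0; apply/eqP.
set h := hprof L v in lin1 lin2 *.
have -> : 0 = (pos a - pos c) * ((pos a - pos a') * (1 - h) + (pos b - pos b') * h)
  - (pos a - pos a') * ((pos a - pos c) * (1 - h) + (pos b - pos d) * h).
  by rewrite lin1 lin2; ring.
ring.
Qed.

(** There are finitely many quadruples of nodes, and for each the linear equation has nonzero slope,
    hence at most one solution. *)
Lemma strand_points_finite L : finite_set
  [set p | exists a b c d v, [/\ uniq [:: a; b; c; d], 0 < v < 1,
     p = strand_point pos L a b v & p = strand_point pos L c d v]].
Proof.
pose F (x : node C * node C * node C * node C) : set (R * R) :=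
  let: (a, b, c, d) := x in [set p | exists v, [/\ uniq [:: a; b; c; d], 0 < v < 1,
     p = strand_point pos L a b v & p = strand_point pos L c d v]].
have F_sub1 x : is_subset1 (F x).
  case: x => [[[a b] c] d] p q [v [U v01 pE pE']] [v' [_ v01' qE qE']].
  have [_ _ _ U'] := uniq4_swap U.
  suff vv' : v = v' by rewrite pE qE vv'.
  apply: (@hprof_inj _ L _ _ (lt01W v01) (lt01W v01')).
  move: pE' qE'; rewrite pE qE /strand_point => -[E1] [E2].
  have slope : pos b - pos a - (pos d - pos c) != 0.
    by apply/eqP => S; apply: (pos_sum U'); lra.
  by apply: (mulfI slope); lra.
apply: (@sub_finite_set _ _ (\bigcup_(x in setT) F x)).
  by move=> p [a [b [c [d [v H]]]]]; exists (a, b, c, d) => //; exists v.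
apply: bigcup_finite => [|x _]; first exact: finite_finset.
have [->|/set0P [p Fp]] := eqVneq (F x) set0; first exact: finite_set0.
by apply: (@sub_finite_set _ _ [set p]) => [q Fq|]; [exact: F_sub1 Fq Fp|exact: finite_set1].
Qed.

Lemma vprof_bounds L (v : R) : 0 < v < 1 -> -1 < vprof L v /\ vprof L v != 0.
Proof.
move=> /andP [v0 v1]; have v10 : 0 < v * (1 - v) by rewrite mulr_gt0 // subr_gt0.
have v1' : v * (1 - v) < 1 by nra.
case: L => /=.
- by split; [lra | rewrite gt_eqF].
- by split; [lra | rewrite oppr_eq0 gt_eqF].
- by split; [lra | rewrite subr_eq0 lt_eqF].
Qed.

Lemma time0 e : time C e 0 0 = 0 :> R.
Proof. by rewrite /time addr0 mul0r. Qed.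

Lemma time1 e : time C e (last_piece C e) 1 = 1 :> R.
Proof. by rewrite /time natr1 divff // gt_eqF // path_length_gt0. Qed.

Lemma interior_point e t : 0 < t < 1 ->
  (exists k, [/\ (0 < k <= last_piece C e)%N, t = time C e k 0
               & path_curve pos e t = (pos (node_at C e k), 0)]) \/
  exists L a b v w, on_strand e t L a b v w.
Proof.
move=> /andP [t0 t1].
have /(time_of C e) [k [u [ke /andP [u0 u1] tE]]] : 0 <= t < 1 by rewrite ltW.
move: u0; rewrite le_eqVlt => /predU1P [uE|u0].
  subst u; left; case: k ke tE => [|k] ke tE.
    by move: t0; rewrite tE time0 ltxx.
  exists k.+1; split=> //; rewrite tE.
  have z01 : 0 <= (0 : R) <= 1 by apply/andP; split; lra.
  by have [-> _] := path_time pos ke z01; have [] := piece_point_start pos ke.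
right; have [|a [b [v [w H]]]] := on_strandP ke (u := u); first by rewrite u0.
by exists (piece_layer C e k), a, b, v, w; rewrite tE.
Qed.

Lemma on_strand_y e t L a b v w : on_strand e t L a b v w ->
  -1 < (path_curve pos e t).2 /\ (path_curve pos e t).2 != 0.
Proof. by move=> [_ [_ [_ _ v01 _ [-> _ _]]]]; exact: vprof_bounds. Qed.

(** Among the interior points of the edges only the ports have height 0, and distinct ports have
    distinct positions, so no double point is a port. *)
Lemma meets_on_strand e s f t : Defs.meets (path_curve pos) e s f t ->
  (exists L a b v w, on_strand e s L a b v w) /\
  (exists L a b v w, on_strand f t L a b v w).
Proof.
move=> [s01 t01 neq E].
case: (interior_point e s01) => [[k [ke sE pE]]|He];
  case: (interior_point f t01) => [[l [lf tE qE]]|Hf] //.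
- case: neq; move: E; rewrite pE qE => -[/pos_inj /(node_at_inj ke lf) [ef kl]].
  by subst f l; rewrite sE tE.
- have [L [a [b [v [w /on_strand_y [_]]]]]] := Hf.
  by rewrite -E pE eqxx.
- have [L [a [b [v [w /on_strand_y [_]]]]]] := He.
  by rewrite E qE eqxx.
Qed.

Lemma path_transverse e s f t : Defs.meets (path_curve pos) e s f t ->
  det2 (velocity (path_curve pos e) s) (velocity (path_curve pos f) t) <> 0.
Proof.
move=> M; have [[L [a [b [v [w He]]]]] [L' [c [d [v' [w' Hf]]]]]] := meets_on_strand M.
by have [_ _ neq E] := M; exact: strand_transverse He Hf neq E.
Qed.

Lemma path_no_triple e s f t g u :
  Defs.meets (path_curve pos) e s f t -> Defs.meets (path_curve pos) e s g u ->
  (f, t) = (g, u).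
Proof.
move=> M M'; have [[L [a [b [v [w He]]]]] [L' [c [d [v' [w' Hf]]]]]] := meets_on_strand M.
have [_ [L'' [a' [b' [v'' [w'' Hg]]]]]] := meets_on_strand M'.
have [_ _ ef Ef] := M; have [_ _ eg Eg] := M'.
exact: strand_no_triple He Hf Hg ef eg Ef Eg.
Qed.

Lemma path_double_finite : finite_set [set p | double_point (path_curve pos) p].
Proof.
apply: (@sub_finite_set _ _ (\bigcup_(L in [set Upper; Lower; Fan])
  [set p | exists a b c d v, [/\ uniq [:: a; b; c; d], 0 < v < 1,
     p = strand_point pos L a b v & p = strand_point pos L c d v]])).
  move=> p [e [s [f [t [M ->]]]]].
  have [[L [a [b [v [w He]]]]] [L' [c [d [v' [w' Hf]]]]]] := meets_on_strand M.
  have [_ _ neq E] := M; have [LL vv _] := strand_meet_layer He Hf E.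
  exists L; first by case: (L); [left; left|left; right|right].
  exists a, b, c, d, v; split; first exact: strand_meet He Hf neq E.
  - by have [_ [_ [_ _ v01 _ _]]] := He.
  - by have [_ [_ [_ _ _ _ [-> _ _]]]] := He.
  - by rewrite E; have [_ [_ [_ _ _ _ [-> _ _]]]] := Hf; rewrite LL vv.
apply: bigcup_finite => [|L _]; last exact: strand_points_finite.
by rewrite !finite_setU; do ![split]; exact: finite_set1.
Qed.

Lemma path_immersed e t : 0 <= t <= 1 -> velocity (path_curve pos e) t <> (0, 0).
Proof.
move=> /andP [t0 t1].
have [k [u [ke u01 ->]]] : exists k u,
    [/\ (k <= last_piece C e)%N, 0 <= u <= 1 & t = time C e k u].
  move: t1; rewrite le_eqVlt => /predU1P [->|t1].
    by exists (last_piece C e), 1; rewrite time1 ler01 lexx.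
  have /(time_of C e) [k [u [ke /andP [u0 u1] tE]]] : 0 <= t < 1 by rewrite t0.
  by exists k, u; rewrite u0 ltW.
have [_ ->] := path_time pos ke u01.
have L0 := path_length_gt0 R C e.
have s0 : piece_sign R C e k != 0.
  by rewrite /piece_sign; case: ifP => _; rewrite ?oppr_eq0 oner_eq0.
rewrite /piece_velocity /strand_velocity /=.
move=> [/eqP + /eqP]; rewrite !mulf_eq0 !(gt_eqF L0) /= !(negPf s0) /=.
rewrite subr_eq0 => /orP [/eqP /pos_inj/esym /(piece_nodes_neq ke) //|].
(* For [Fan] the vertical speed never vanishes; for an arc it vanishes only at 1/2, where the
   horizontal one does not. *)
case: piece_layer => /=; rewrite ?oner_eq0 // => /eqP E1 /eqP E2; nra.
Qed.

(** * Edge-ends at the vertices *)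

Definition end_port (h : edge_end G) : node C :=
  node_at C h.1 (if h.2 then last_piece C h.1 else 1%N).

Lemma end_port_inj : injective end_port.
Proof.
have bd e (x : bool) : (0 < (if x then last_piece C e else 1) <= last_piece C e)%N.
  by case: x; rewrite ?leqnn.
move=> [e x] [f y] /(node_at_inj (bd e x) (bd f y)) [<-].
by case: x; case: y.
Qed.

Lemma path_end e :
  [/\ path_curve pos e 0 = (pos (inl (source e)), -1),
      path_curve pos e 1 = (pos (inl (target e)), -1)
    & forall x, end_direction (path_curve pos) (e, x) =
       (path_length R C e * (4 / 3 * (pos (end_port (e, x)) -
                                      pos (inl (end_vertex (e, x))))),
        path_length R C e)].
Proof.
have z01 : 0 <= (0 : R) <= 1 by apply/andP; split; lra.
have o01 : 0 <= (1 : R) <= 1 by apply/andP; split; lra.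
have [P0 V0] := path_time pos (leq0n (last_piece C e)) z01.
have [P1 V1] := path_time pos (leqnn (last_piece C e)) o01.
have half : (0 : R) <= 1 / 2 by lra.
rewrite time0 in P0 V0; rewrite time1 in P1 V1; split.
- by rewrite P0 /piece_point /strand_point hprof0 mulr0 addr0 /= sub0r.
- rewrite P1 /piece_point /strand_point /piece_param /piece_start /piece_rev eqxx.
  by rewrite subrr hprof0 mulr0 addr0 /piece_layer eqxx orbT /node_at /= eqxx sub0r.
- case.
    rewrite (_ : end_direction _ _ = (- (velocity (path_curve pos e) 1).1,
                                      - (velocity (path_curve pos e) 1).2)) //.
    rewrite V1 /piece_velocity /piece_sign /piece_param
      /piece_start /piece_stop /piece_rev /piece_layer eqxx orbT /=.
    rewrite subrr half /end_port /end_vertex /= /node_at /= eqxx /=.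
    by congr (_, _); ring.
  rewrite (_ : end_direction _ _ = velocity (path_curve pos e) 0) //.
  rewrite V0 /piece_velocity /piece_sign /piece_param
    /piece_start /piece_stop /piece_rev /piece_layer /= half /end_port /end_vertex /=.
  by congr (_, _); ring.
Qed.

Lemma path_end_straight (h : edge_end G) : exists2 eps : R, 0 < eps &
  forall t, 0 <= t <= eps -> exists2 r : R, 0 <= r &
    end_point (path_curve pos) h t =
      (pos (inl (end_vertex h)) + r * (end_direction (path_curve pos) h).1,
       -1 + r * (end_direction (path_curve pos) h).2).
Proof.
case: h => e x; have [_ _ ->] := path_end e.
have L0 := path_length_gt0 R C e.
(* This is the time spent on the half strand where [hprof Fan] is linear; there the required
   multiple [r] is [t] itself. *)
exists (1 / 2 / path_length R C e); first by rewrite divr_gt0.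
move=> t /andP [t0]; rewrite ler_pdivlMr // mulrC => t1.
have tL0 : 0 <= path_length R C e * t by rewrite mulr_ge0 // ltW.
exists t => //=; rewrite /end_point /=; case: x.
  have -> : 1 - t = time C e (last_piece C e) (1 - path_length R C e * t).
    rewrite /time addrA natr1 -/(path_length R C e) mulrBl divff ?gt_eqF //.
    by rewrite mulrAC divff ?gt_eqF // mul1r.
  have u01 : 0 <= 1 - path_length R C e * t <= 1 by apply/andP; split; lra.
  have [-> _] := path_time pos (leqnn (last_piece C e)) u01.
  rewrite /piece_point /strand_point /piece_param /piece_start /piece_stop
    /piece_rev /piece_layer eqxx orbT /=.
  rewrite subKr t1 /end_port /end_vertex /= /node_at /= eqxx /=.
  by congr (_, _); ring.
have tE : t = time C e 0 (path_length R C e * t).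
  by rewrite /time add0r mulrAC divff ?gt_eqF // mul1r.
have u01 : 0 <= path_length R C e * t <= 1 by apply/andP; split; lra.
have [Pt _] := path_time pos (leq0n (last_piece C e)) u01.
rewrite {1}tE Pt /piece_point /strand_point /piece_param /piece_start /piece_stop
  /piece_rev /piece_layer /= t1 /end_port /end_vertex /=.
by congr (_, _); ring.
Qed.

(** All directions at a vertex point upwards, so the determinant only compares slopes, that is,
    abscissas of ports; 4/3 is the initial slope of [hprof Fan]. *)
Lemma end_det (h k : edge_end G) : end_vertex h = end_vertex k ->
  det2 (end_direction (path_curve pos) h) (end_direction (path_curve pos) k) =
  path_length R C h.1 * path_length R C k.1 * (4 / 3) *
    (pos (end_port h) - pos (end_port k)).
Proof.
case: h k => [e x] [f y] hk.
have [_ _ ->] := path_end e; have [_ _ ->] := path_end f.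
by rewrite /det2 /= hk; ring.
Qed.

Lemma end_det_gt0 (h k : edge_end G) : end_vertex h = end_vertex k ->
  pos (end_port k) < pos (end_port h) ->
  0 < det2 (end_direction (path_curve pos) h) (end_direction (path_curve pos) k).
Proof.
move=> hk lt_kh; rewrite end_det // mulr_gt0 ?subr_gt0 //.
by rewrite !mulr_gt0 ?path_length_gt0.
Qed.

Lemma path_end_distinct (h k : edge_end G) : end_vertex h = end_vertex k ->
  h <> k -> ~ same_direction (end_direction (path_curve pos) h)
                             (end_direction (path_curve pos) k).
Proof.
move=> hk neq [r r0 dE]; have := end_det hk; rewrite {1}/det2 dE /=.
rewrite mulrAC subrr => /esym/eqP.
rewrite !mulf_eq0 !(gt_eqF (path_length_gt0 _ _ _)) /=.
by rewrite invr_eq0 !pnatr_eq0 /= subr_eq0 => /eqP /pos_inj /end_port_inj.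
Qed.

(* The first arc surrounds the second one and its midpoint is further right, so
   both meeting points are in its first half. *)
Lemma lower_crossing e k f l (positive : bool) :
  (k <= last_piece C e)%N -> (l <= last_piece C f)%N ->
  piece_layer C e k = Lower -> piece_layer C f l = Lower ->
  pos (piece_start C e k) < pos (piece_start C f l) ->
  pos (piece_start C f l) < pos (piece_stop C f l) ->
  2 * pos (piece_stop C f l) <= pos (piece_stop C e k) ->
  0 < pos (piece_start C e k) ->
  exists u v, [/\ 0 < u < 1, 0 < v < 1,
    path_curve pos e (time C e k u) = path_curve pos f (time C f l v)
  & (0 < det2 (velocity (path_curve pos e) (time C e k u))
             (velocity (path_curve pos f) (time C f l v))) = positive].
Proof.
move=> ke lf Lk Ll.
have [|k0 _ _ _ rk] := arc_nodes ke; first by rewrite Lk.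
have [|l0 _ _ _ rl] := arc_nodes lf; first by rewrite Ll.
have Pe u : 0 < u < 1 -> path_curve pos e (time C e k u) =
    strand_point pos Lower (piece_start C e k) (piece_stop C e k) u /\
  velocity (path_curve pos e) (time C e k u) =
   (path_length R C e * ((pos (piece_stop C e k) - pos (piece_start C e k)) * dhprof Lower u),
    path_length R C e * dvprof Lower u).
  move=> u01; have [-> ->] := path_time pos ke (lt01W u01).
  by rewrite /piece_point /piece_velocity /piece_param /piece_sign rk Lk /= !mul1r.
have Pf u : 0 < u < 1 -> path_curve pos f (time C f l u) =
    strand_point pos Lower (piece_start C f l) (piece_stop C f l) u /\
  velocity (path_curve pos f) (time C f l u) =
   (path_length R C f * ((pos (piece_stop C f l) - pos (piece_start C f l)) * dhprof Lower u),
    path_length R C f * dvprof Lower u).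
  move=> u01; have [-> ->] := path_time pos lf (lt01W u01).
  by rewrite /piece_point /piece_velocity /piece_param /piece_sign rl Ll /= !mul1r.
move: Pe Pf; set a := pos (piece_start C e k); set b := pos (piece_stop C e k).
set c := pos (piece_start C f l); set d := pos (piece_stop C f l) => Pe Pf.
move=> ac cd db a0.
have Le := path_length_gt0 R C e; have Lf := path_length_gt0 R C f.
case: positive.
(* Outer arc going down, inner arc going up at parameter [1 - u]: the profile value solves a + (b -
   a)h = d - (d - c)h. It is below 1/2 because c + d < 2d <= b < a + b. *)
- have den : 0 < (d - a) + (b - c) by lra.
  have [|u /andP [u0 u2] hu] := @arc_hprof_surj R ((d - a) / ((d - a) + (b - c))).
    by apply/andP; split; [rewrite divr_gt0 //; lra | rewrite ltr_pdivrMr //; lra].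
  have u01 : 0 < u < 1 by apply/andP; split; lra.
  have u01' : 0 < 1 - u < 1 by apply/andP; split; lra.
  have [Pu Vu] := Pe u u01; have [Pv Vv] := Pf _ u01'.
  exists u, (1 - u); split=> //.
    rewrite Pu Pv /strand_point hprof_flip // hu; congr (_, _); last by rewrite /=; ring.
    by rewrite -/a -/b -/c -/d; field; rewrite gt_eqF.
  rewrite Vu Vv /det2 /=; set X := (X in 0 < X).
  have -> : X = path_length R C e * path_length R C f * (6 * u * (1 - u)) *
     ((1 - 2 * u) * (b - a + (d - c))) by rewrite /X; ring.
  by rewrite !mulr_gt0 //; lra.
(* Both arcs going down at the same parameter: a + (b - a)h = c + (d - c)h. The outer arc is wider,
   hence flatter, and the sign is reversed. *)
- have den : 0 < (c - a) + (b - d) by lra.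
  have [|u /andP [u0 u2] hu] := @arc_hprof_surj R ((c - a) / ((c - a) + (b - d))).
    by apply/andP; split; [rewrite divr_gt0 //; lra | rewrite ltr_pdivrMr //; lra].
  have u01 : 0 < u < 1 by apply/andP; split; lra.
  have [Pu Vu] := Pe u u01; have [Pv Vv] := Pf u u01.
  exists u, u; split=> //.
    rewrite Pu Pv /strand_point hu; congr (_, _).
    by rewrite -/a -/b -/c -/d; field; rewrite gt_eqF.
  rewrite Vu Vv /det2 /=; set X := (X in 0 < X).
  have -> : X = - (path_length R C e * path_length R C f * (6 * u * (1 - u)) *
     ((1 - 2 * u) * (b - a - (d - c)))) by rewrite /X; ring.
  apply/negbTE; rewrite -leNgt oppr_le0 ltW // !mulr_gt0 //; lra.
Qed.

End Incidences.

(** * Placing the ports *)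

Section Layout.
Variables (R : realType) (G : digraph) (A : eqType) (C : gauss_code G A).

(* Ports in increasing order: starts of over-passages, starts and ends of
   under-passages, ends of over-passages, then the ports of the edge-ends, which
   leave each vertex upwards, hence counterclockwise from right to left. *)
Definition node_group (r : edge_end G -> nat) (x : node C) : nat :=
  match x with
  | inl _ => 4
  | inr (e, k) =>
      if k == 1%N :> nat then (4 + r (e, false))%N
      else if onth (word C e) k./2.-1 is Some x then
             if is_over x then if odd k then 3 else 0
             else if odd k then 2 else 1
           else (4 + r (e, true))%N
  end.

(** The map [k./2.-1] sends both ports 2i + 2 and 2i + 3 of passage [i] to [i], and the last port to
    an index beyond the word. It sends port 1 to 0, which would clash with passage 0, hence the
    separate test. *)
Lemma port_group r e k : (0 < k <= last_piece C e)%N ->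
  node_group r (node_at C e k) =
    if k == 1%N :> nat then (4 + r (e, false))%N
    else if onth (word C e) k./2.-1 is Some x then
           if is_over x then if odd k then 3 else 0
           else if odd k then 2 else 1
         else (4 + r (e, true))%N.
Proof.
move=> ke; rewrite portE //= inordK //.
by have /andP [_ /leq_trans] := ke; apply; exact: leq_bigmax.
Qed.

Lemma end_port_group r h : node_group r (end_port C h) = (4 + r h)%N.
Proof.
case: h => e [].
  rewrite -[end_port C _]/(node_at C e (last_piece C e)) port_group ?leqnn //=.
  by rewrite doubleK onth_default.
by rewrite -[end_port C _]/(node_at C e 1) port_group.
Qed.

Lemma passage_piece e i x : onth (word C e) i = Some x ->
  [/\ (i.*2.+2 < last_piece C e)%N, piece_layer C e i.*2.+2 = Lower,
      piece_start C e i.*2.+2 = node_at C e i.*2.+2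
    & piece_stop C e i.*2.+2 = node_at C e i.*2.+3].
Proof.
move=> xi; have ilt : (i < size (word C e))%N by rewrite -onthTE xi.
have lt_i : (i.*2.+2 < last_piece C e)%N by rewrite /last_piece; lia.
rewrite /piece_layer /piece_start /piece_stop /piece_rev (ltn_eqF lt_i) /=.
by rewrite odd_double.
Qed.

Lemma passage_group r e i x : onth (word C e) i = Some x ->
  node_group r (piece_start C e i.*2.+2) = (if is_over x then 0 else 1)%N /\
  node_group r (piece_stop C e i.*2.+2) = (if is_over x then 3 else 2)%N.
Proof.
move=> xi; have [lt_i _ -> ->] := passage_piece xi.
rewrite !port_group ?(ltnW lt_i) //= odd_double uphalf_double doubleK xi.
by case: ifP.
Qed.

Lemma layout_exists : exists pos : node C -> R,
  [/\ generic_layout pos,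
      forall h k, end_vertex k = end_vertex h -> k <> h -> k <> rotation C h ->
        [\/ pos (end_port C k) < pos (end_port C (rotation C h)) < pos (end_port C h),
            pos (end_port C (rotation C h)) < pos (end_port C h) < pos (end_port C k)
          | pos (end_port C h) < pos (end_port C k) < pos (end_port C (rotation C h))]
    & forall e i x f j y,
        onth (word C e) i = Some x -> onth (word C f) j = Some y ->
        is_over x -> ~~ is_over y ->
        let a := piece_start C e i.*2.+2 in let b := piece_stop C e i.*2.+2 in
        let c := piece_start C f j.*2.+2 in let d := piece_stop C f j.*2.+2 in
        [/\ pos a < pos c, pos c < pos d, 2 * pos d <= pos b & 0 < pos a]].
Proof.
have [r rP] := perm_rank (rotation C).
have [pos [pos0 pos2 pos_inj pos_sum pos_det]] := generic_positions R (node_group r).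
have pos_lt a b : (node_group r a < node_group r b)%N -> pos a < pos b.
  by move=> /pos2; have := pos0 a; lra.
exists pos; split.
- split=> // e k f l a b ke lf Fk Ll ak bl; apply: pos_lt.
  (* Ports of passages lie in groups 0 to 3, vertices and ports of edge-ends in groups from 4 on. *)
  apply: (@leq_trans 4).
    have [|l0 ll sl tl _] := arc_nodes lf; first by rewrite Ll.
    have [i lE] : exists i, l = i.*2.+2.
      exists l./2.-1; move: Ll; rewrite /piece_layer; case: (_ || _) => //.
      by case: ifP => // even_l _; lia.
    subst l; case xi: (onth (word C f) i) => [x|]; last first.
      by move/negbT: (congr1 isSome xi); rewrite onthNE; move: ll; rewrite /last_piece; lia.
    have [ga gb] := passage_group r xi.
    by move: bl; rewrite !inE => /orP [/eqP ->|/eqP ->]; rewrite ?ga ?gb; case: ifP.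
  have [x [j [sE tE je jdef]]] := fan_nodes ke Fk.
  move: ak; rewrite !inE sE => /orP [/eqP -> //|/eqP ->].
  rewrite tE port_group //; case: eqP => [_|]; first exact: leq_addr.
  rewrite jdef; case: (k == 0%N) => // _.
  by rewrite /last_piece /= doubleK onth_default ?leq_addr.
- move=> h k hk kh krh.
  have kporb : k \in porbit (rotation C) h by rewrite rotationP hk eqxx.
  by case: (rP h k kporb kh krh) => /andP [lt1 lt2]; [apply: Or31|apply: Or32|apply: Or33];
    rewrite !pos_lt // !end_port_group ltn_add2l.
- move=> e i x f j y xi yj xo yu /=.
  have [ga gb] := passage_group r xi; have [gc gd] := passage_group r yj.
  rewrite xo (negPf yu) in ga gb gc gd.
  by split; [apply: pos_lt|apply: pos_lt|apply: pos2|exact: pos0];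
    rewrite ?ga ?gb ?gc ?gd.
Qed.

End Layout.

(** * Classical passages *)

Section Passages.
Variables (R : realType) (G : digraph) (A : eqType) (C : gauss_code G A).
Variable pos : node C -> R.
Hypothesis pos_generic : generic_layout pos.
Hypothesis pos_nested : forall e i x f j y,
  onth (word C e) i = Some x -> onth (word C f) j = Some y ->
  is_over x -> ~~ is_over y ->
  let a := piece_start C e i.*2.+2 in let b := piece_stop C e i.*2.+2 in
  let c := piece_start C f j.*2.+2 in let d := piece_stop C f j.*2.+2 in
  [/\ pos a < pos c, pos c < pos d, 2 * pos d <= pos b & 0 < pos a].

(** Two different occurrences of a symbol have opposite labels, so symbol and label determine the
    occurrence. *)
Lemma mate_unique e i x f j y g k z :
  onth (word C e) i = Some x -> onth (word C f) j = Some y ->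
  onth (word C g) k = Some z ->
  symbol y = symbol x -> symbol z = symbol x ->
  is_over y = is_over z -> (f, j) = (g, k).
Proof.
move=> xi yj zk yx zx yz; apply: contrapT => neq.
have [_] := word_match neq yj zk (etrans yx (esym zx)).
by rewrite yz; case: is_over.
Qed.

(** [U a] holds the parameters of the over-passage and of the under-passage of [a]. By [mate_unique]
    a single pair suffices for each symbol; symbols without such passages get the default 1/2. *)
Lemma crossing_params : exists U : A -> R * R,
  (forall a, 0 < (U a).1 < 1 /\ 0 < (U a).2 < 1) /\
  forall e i x f j y,
    onth (word C e) i = Some x -> onth (word C f) j = Some y ->
    symbol y = symbol x -> is_over x -> ~~ is_over y ->
    let s := time C e i.*2.+2 (U (symbol x)).1 in
    let t := time C f j.*2.+2 (U (symbol x)).2 in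
    path_curve pos e s = path_curve pos f t /\
    (0 < det2 (velocity (path_curve pos e) s) (velocity (path_curve pos f) t)) =
      is_pos x.
Proof.
pose P (a : A) (U : R * R) := [/\ 0 < U.1 < 1, 0 < U.2 < 1 &
  forall e i x f j y,
    onth (word C e) i = Some x -> onth (word C f) j = Some y ->
    symbol x = a -> symbol y = a -> is_over x -> ~~ is_over y ->
    let s := time C e i.*2.+2 U.1 in let t := time C f j.*2.+2 U.2 in
    path_curve pos e s = path_curve pos f t /\
    (0 < det2 (velocity (path_curve pos e) s) (velocity (path_curve pos f) t)) =
      is_pos x].
suff /choice [U UP] : forall a, exists U, P a U.
  exists U; split=> [a|e i x f j y xi yj yx xo yu]; first by have [] := UP a.
  by have [_ _ H] := UP (symbol x); exact: H xi yj erefl yx xo yu.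
move=> a.
case: (pselect (exists e i x f j y, [/\ onth (word C e) i = Some x,
    onth (word C f) j = Some y, symbol x = a, symbol y = a & is_over x && ~~ is_over y])).
  move=> [e [i [x [f [j [y [xi yj xa ya /andP [xo yu]]]]]]]].
  have [lt_i Li _ _] := passage_piece xi; have [lt_j Lj _ _] := passage_piece yj.
  have [ac cd db a0] := pos_nested xi yj xo yu.
  have [u [v [u01 v01 E S]]] := lower_crossing (is_pos x)
    (ltnW lt_i) (ltnW lt_j) Li Lj ac cd db a0.
  exists (u, v); split=> // e' i' x' f' j' y' xi' yj' xa' ya' xo' yu' /=.
  have [ee ii] : (e, i) = (e', i').
    by apply: (mate_unique xi xi xi'); rewrite ?xa // xo xo'.
  have [ff jj] : (f, j) = (f', j').
    by apply: (mate_unique xi yj yj'); rewrite ?xa // (negPf yu) (negPf yu').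
  subst e' i' f' j'; split=> //; rewrite S.
  by move: xi'; rewrite xi => -[->].
move=> none; exists (1 / 2, 1 / 2); split=> /=; [exact: half01|exact: half01|].
move=> e i x f j y xi yj xa ya xo yu; exfalso; apply: none.
by exists e, i, x, f, j, y; split=> //; rewrite xo.
Qed.

Variable U : A -> R * R.
Hypothesis U01 : forall a, 0 < (U a).1 < 1 /\ 0 < (U a).2 < 1.
Hypothesis UP : forall e i x f j y,
  onth (word C e) i = Some x -> onth (word C f) j = Some y ->
  symbol y = symbol x -> is_over x -> ~~ is_over y ->
  let s := time C e i.*2.+2 (U (symbol x)).1 in
  let t := time C f j.*2.+2 (U (symbol x)).2 in
  path_curve pos e s = path_curve pos f t /\
  (0 < det2 (velocity (path_curve pos e) s) (velocity (path_curve pos f) t)) =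
    is_pos x.

Definition passage_param (x : gauss_entry A) : R :=
  if is_over x then (U (symbol x)).1 else (U (symbol x)).2.

Definition passage_time e i : R :=
  if onth (word C e) i is Some x then time C e i.*2.+2 (passage_param x) else 0.

Definition passage_times e : seq R := mkseq (passage_time e) (size (word C e)).

(** Off the list [index] returns its size, where [onth] gives [None]: every double point not
    prescribed by the code is virtual. *)
Definition passage_strand e s : option bool :=
  omap (@is_over A) (onth (word C e) (index s (passage_times e))).

Lemma passage_timeE e i x : onth (word C e) i = Some x ->
  passage_time e i = time C e i.*2.+2 (passage_param x).
Proof. by rewrite /passage_time => ->. Qed.

Lemma passage_param01 x : 0 < passage_param x < 1.
Proof. by have [? ?] := U01 (symbol x); rewrite /passage_param; case: ifP. Qed.

Lemma passage_time01 e i x : onth (word C e) i = Some x -> 0 < passage_time e i < 1.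
Proof.
move=> xi; rewrite (passage_timeE xi) /time.
have [lt_i _ _ _] := passage_piece xi; have /andP [p0 p1] := passage_param01 x.
have L0 := path_length_gt0 R C e; apply/andP; split.
  by rewrite divr_gt0 // ltr_wpDl.
rewrite ltr_pdivrMr // mul1r /path_length -(natr1 (last_piece C e)).
by apply: ler_ltD; rewrite // ler_nat ltnW.
Qed.

Lemma passage_time_lt e i j x y : onth (word C e) i = Some x ->
  onth (word C e) j = Some y -> (i < j)%N -> passage_time e i < passage_time e j.
Proof.
move=> xi yj ij; rewrite (passage_timeE xi) (passage_timeE yj) /time.
rewrite ltr_pM2r ?invr_gt0 ?path_length_gt0 //.
have /andP [_ x1] := passage_param01 x; have /andP [y0 _] := passage_param01 y.
have : (i.*2.+2).+1%:R <= (j.*2.+2)%:R :> R by rewrite ler_nat; lia.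
by rewrite -natr1; lra.
Qed.

Lemma passage_time_inj e i x f j y :
  onth (word C e) i = Some x -> onth (word C f) j = Some y ->
  (e, passage_time e i) = (f, passage_time f j) -> (e, i) = (f, j).
Proof.
move=> xi yj [ef]; subst f => E; case: (ltngtP i j) => ij; last by rewrite ij.
  by have := passage_time_lt xi yj ij; rewrite E ltxx.
by have := passage_time_lt yj xi ij; rewrite E ltxx.
Qed.

Lemma passage_times_nth e i x : onth (word C e) i = Some x ->
  (i < size (word C e))%N /\ nth 0 (passage_times e) i = passage_time e i.
Proof.
by move=> xi; have ilt : (i < size (word C e))%N;
  [rewrite -onthTE xi | rewrite nth_mkseq].
Qed.

Lemma onth_some e i : (i < size (word C e))%N -> exists x, onth (word C e) i = Some x.
Proof. by rewrite -onthTE; case: onth => // x _; exists x. Qed.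

Lemma passage_times_sorted e : sorted <%R (passage_times e).
Proof.
apply/(sortedP 0) => i; rewrite size_mkseq => lt_i.
have [x xi] := onth_some (ltnW lt_i); have [y yi] := onth_some lt_i.
by rewrite !nth_mkseq ?(ltnW lt_i) //; exact: passage_time_lt xi yi _.
Qed.

Lemma passage_timesP e s : s \in passage_times e <->
  exists i x, onth (word C e) i = Some x /\ s = passage_time e i.
Proof.
split=> [/(nthP 0) [i]|[i [x [xi ->]]]].
  rewrite size_mkseq => lt_i; rewrite nth_mkseq // => <-.
  by have [x xi] := onth_some lt_i; exists i, x.
have [lt_i <-] := passage_times_nth xi.
by rewrite mem_nth // size_mkseq.
Qed.

Lemma strand_passage e i x : onth (word C e) i = Some x ->
  passage_strand e (passage_time e i) = Some (is_over x).
Proof.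
move=> xi; have [lt_i <-] := passage_times_nth xi.
rewrite /passage_strand index_uniq ?size_mkseq ?xi //.
exact/lt_sorted_uniq/passage_times_sorted.
Qed.

Lemma strand_notin e s : s \notin passage_times e -> passage_strand e s = None.
Proof.
rewrite -index_mem -leqNgt size_mkseq /passage_strand => le_s.
by rewrite onth_default.
Qed.

Lemma meets_sym e s f t :
  Defs.meets (path_curve pos) e s f t -> Defs.meets (path_curve pos) f t e s.
Proof. by move=> [s01 t01 neq E]; split=> // E'; apply: neq. Qed.

Lemma mates_meet e i x f j y :
  onth (word C e) i = Some x -> onth (word C f) j = Some y ->
  symbol y = symbol x -> (e, i) <> (f, j) ->
  [/\ is_pos y = is_pos x, is_over y = ~~ is_over x,
      Defs.meets (path_curve pos) e (passage_time e i) f (passage_time f j)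
    & is_over x ->
      (0 < det2 (velocity (path_curve pos e) (passage_time e i))
                (velocity (path_curve pos f) (passage_time f j))) = is_pos x].
Proof.
move=> xi yj yx neq.
have [px ox] := word_match neq xi yj (esym yx).
have neq_time : (e, passage_time e i) <> (f, passage_time f j).
  by move/(passage_time_inj xi yj).
have H : path_curve pos e (passage_time e i) = path_curve pos f (passage_time f j) /\
    (is_over x -> (0 < det2 (velocity (path_curve pos e) (passage_time e i))
      (velocity (path_curve pos f) (passage_time f j))) = is_pos x).
  rewrite (passage_timeE xi) (passage_timeE yj) /passage_param yx ox.
  case oy : (is_over y) ox => /= ox.
    by have [E _] := UP yj xi (esym yx) oy (negbT ox); rewrite -yx E.
  by have [E S] := UP xi yj yx ox (negbT oy).
split=> //; first by rewrite ox negbK.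
- by split=> //; [exact: passage_time01 xi|exact: passage_time01 yj|case: H].
- by case: H.
Qed.

(** At a passage time the mate passes through the same point, and without triple points it is the
    strand met there, with the opposite label. If [s] is no passage time, the same argument from the
    other side shows that [t] is none either. *)
Lemma strand_meets e s f t : Defs.meets (path_curve pos) e s f t ->
  passage_strand f t = omap negb (passage_strand e s).
Proof.
move=> M; case: (boolP (s \in passage_times e)) => [/passage_timesP [i [x [xi sE]]]|s_out].
  have [f' [j [y [yj yx neq]]]] := passage_mate xi.
  have [_ oy M' _] := mates_meet xi yj yx neq.
  rewrite sE in M *; have [-> ->] := path_no_triple pos_generic M M'.
  by rewrite (strand_passage xi) (strand_passage yj) oy.
rewrite (strand_notin s_out) strand_notin //.
apply/negP => /passage_timesP [j [y [yj tE]]].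
have [e' [i [x [xi xy neq]]]] := passage_mate yj.
have [_ _ M' _] := mates_meet yj xi xy neq.
move: (meets_sym M); rewrite tE => M''.
have [ee ss] := path_no_triple pos_generic M'' M'; subst e'.
by move/negP: s_out; apply; apply/passage_timesP; exists i, x.
Qed.

End Passages.

Theorem theorem1 (R : realType) (G : digraph) (hG : connected_graph G)
    (A : eqType) (C : gauss_code G A) :
  exists D : virtual_diagram R G, is_gauss_code_of D C.
Proof.
have [pos [pos_generic pos_rotation pos_nested]] := layout_exists R C.
have [U [U01 UP]] := crossing_params pos_nested.
have [pos_inj _ _ _] := pos_generic.
have ends e := path_end pos e.
pose place (v : vertex G) : R * R := (pos (inl v), -1).
have interior_y e t : 0 < t < 1 -> -1 < (path_curve pos e t).2.
  by move=> /(interior_point pos e) [[k [_ _ ->]]|[L [a [b [v [w /on_strand_y []]]]]]] //=.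
have place_injective : injective place by move=> v w [/pos_inj []].
have vertex_simple_path e t v : 0 < t < 1 -> path_curve pos e t <> place v.
  by move=> /(interior_y e) + E; rewrite E ltxx.
pose D := @VirtualDiagram R G place (path_curve pos) (passage_strand C U)
  (fun e => let: And3 H _ _ := ends e in H)
  (fun e => let: And3 _ H _ := ends e in H)
  (path_C1_curve pos) (path_immersed pos_generic) place_injective
  vertex_simple_path (path_end_straight pos) (path_end_distinct pos_generic)
  (path_double_finite pos_generic) (path_transverse pos_generic)
  (path_no_triple pos_generic) (strand_meets pos_generic U01 UP).
exists D; split.
  move=> h k hk kh krh.
  have hr : end_vertex (rotation C h) = end_vertex h.
    apply/eqP; rewrite -(rotationP C) -[rotation C h]/((rotation C ^+ 1)%g h).
    exact: mem_porbit.
  (* A port further right comes earlier counterclockwise, so each cyclic arrangement of the three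
     positions yields two positive determinants. *)
  case: (pos_rotation h k hk kh krh) => /andP [lt1 lt2].
  - by apply: Or31; split; apply: end_det_gt0; rewrite ?hr ?hk.
  - by apply: Or33; split; apply: end_det_gt0; rewrite ?hr ?hk.
  - by apply: Or32; split; apply: end_det_gt0; rewrite ?hr ?hk.
have passageP e s : s \in passage_times C U e <-> classical_passage D e s.
  split.
    move=> /(passage_timesP C U e s) [i [x [xi ->]]].
    have [f [j [y [yj yx neq]]]] := passage_mate xi.
    have [_ _ M _] := mates_meet U01 UP xi yj yx neq.
    split; first by exists f, (passage_time C U f j).
    by rewrite /= (strand_passage U01 xi).
  move=> [_ s_strand]; apply: contrapT => /negP /strand_notin.
  exact: s_strand.
(* The symbol depends only on the point: two passages through [p] are equal or mates, as there are
   no triple points. *)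
have label_at (p : R * R) : exists o : option A, forall e i x,
    onth (word C e) i = Some x -> p = path_curve pos e (passage_time C U e i) ->
    o = Some (symbol x).
  case: (pselect (exists e i x, onth (word C e) i = Some x /\
      p = path_curve pos e (passage_time C U e i))) => [[e [i [x [xi pE]]]]|none].
    exists (Some (symbol x)) => f j y yj qE; congr Some.
    case: (pselect ((e, i) = (f, j))) => [[ef ij]|neq].
      by subst f j; move: yj; rewrite xi => -[->].
    have [g [k [z [zk zx neq']]]] := passage_mate xi.
    have [_ _ M _] := mates_meet U01 UP xi zk zx neq'.
    have M' : Defs.meets (path_curve pos) e (passage_time C U e i) f (passage_time C U f j).
      split; [exact: passage_time01 xi|exact: passage_time01 yj| |by rewrite -pE qE].
      by move/(passage_time_inj U01 xi yj).
    have := passage_time_inj U01 zk yj (path_no_triple pos_generic M M').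
    by move=> [ef kj]; subst f k; move: zk; rewrite yj => -[->].
  exists None => e i x xi pE; case: none; by exists e, i, x.
have [label labelP] := choice label_at.
exists label; split.
  move=> p q [e [s [es ->]]] [f [t [ft ->]]].
  move/passageP/passage_timesP: es => [i [x [xi ->]]].
  move/passageP/passage_timesP: ft => [j [y [yj ->]]].
  rewrite (labelP _ _ _ _ xi erefl) (labelP _ _ _ _ yj erefl) => -[xy].
  case: (pselect ((e, i) = (f, j))) => [[-> ->] //|neq].
  by have [_ _ [_ _ _ E] _] := mates_meet U01 UP xi yj (esym xy) neq.
move=> e; exists (passage_times C U e); split=> //.
- exact: passage_times_sorted.
- by rewrite size_mkseq.
move=> i s x si xi.
have sE : s = passage_time C U e i.
  have [_ <-] := passage_times_nth U xi.
  by rewrite (onth_nth 0 _ _ _ si).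
subst s; split; first exact: labelP xi erefl.
  by rewrite /= (strand_passage U01 xi).
move=> f t M.
have [g [k [z [zk zx neq]]]] := passage_mate xi.
have [pz oz M' S] := mates_meet U01 UP xi zk zx neq.
have [_ _ _ S'] := mates_meet U01 UP zk xi (esym zx) (fun E => neq (esym E)).
have [-> ->] := path_no_triple pos_generic M M'.
(* The sign is computed with the over strand first, so for an under-passage it is taken from the
   mate. *)
case: ifP => xo; first by rewrite -S.
by rewrite -pz -S' // oz xo.
Qed.
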